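(* Let $K$ be an arbitrary field, let $\mathcal{L}$ be a set of $m$ distinct lines and $\mathcal{P}$ a set of $n$ distinct points in $K^3$. Let $c$ be a constant such that no plane contains more than $c\sqrt{m}$ of the lines. Then the number of incidences satisfies $$I(\mathcal{L},\mathcal{P})\leq 2.45\,mn^{2/5}+2.45\,n^{6/5}+0.91\,c^2mn^{1/3}+6.74\,n.$$
   Context: Lines and planes are affine lines and planes in $K^3$ (defined over $K$). An incidence is a pair $(p,\ell)$ with $p\in\mathcal{P}$, $\ell\in\mathcal{L}$ and $p\in\ell$; $I(\mathcal{L},\mathcal{P})$ denotes the total number of incidences, i.e. $I(\mathcal{L},\mathcal{P})=\sum_{p\in\mathcal{P}} r(p)$, where $r(p)$ is the number of lines of $\mathcal{L}$ passing through $p$. *)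

(* Defs.v *)
From HB Require Import structures.
From mathcomp Require Import all_boot all_order all_algebra finmap.
From mathcomp Require Import boolp classical_sets reals exp.

Set Implicit Arguments.
Unset Strict Implicit.
Unset Printing Implicit Defensive.

Import Order.TTheory GRing.Theory Num.Theory.

Local Open Scope ring_scope.

Definition affine_flat (K : fieldType) (d : nat) (A : set 'rV[K]_3) : Prop :=
  exists (p : 'rV[K]_3) (U : {vspace 'rV[K]_3}),
    \dim U = d /\ A = [set x | x - p \in U]%classic.

Definition is_line (K : fieldType) (A : set 'rV[K]_3) : Prop := affine_flat 1 A.

Definition is_plane (K : fieldType) (A : set 'rV[K]_3) : Prop := affine_flat 2 A.

Definition lines_in (K : fieldType) (L : {fset set 'rV[K]_3})
    (H : set 'rV[K]_3) : {fset set 'rV[K]_3} :=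
  [fset l in L | `[< (l `<=` H)%classic >]]%fset.

Definition lines_through (K : fieldType) (L : {fset set 'rV[K]_3})
    (p : 'rV[K]_3) : {fset set 'rV[K]_3} :=
  [fset l in L | p \in l]%fset.

Definition incidences (K : fieldType) (L : {fset set 'rV[K]_3})
    (P : {fset 'rV[K]_3}) : nat :=
  (\sum_(p <- P) #|` lines_through L p|)%N.

(* Main.v *)
(**
Let D be the least degree of a nonzero polynomial F vanishing on the points, so
D^3 <= 6n.  With A ~ 2.45 n^(1/5) + 6.74, Y ~ n^(2/5) and k ~ c sqrt m, one shows
  I <= (Y + D) m + A n + D k^2 / 2
by induction on the number of lines and points.  A plane dividing F is split off
together with its points: in it a point on r lines is charged 1 + C(r, 2).  A line
with at most Y + D points, or a point on at most A lines, is removed.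

In the remaining configuration all lines lie on F = 0, and every factor of F has
degree > A: otherwise all points lying only on that factor f would be singular on
it (at a smooth point the more than A >= deg f lines fill the tangent plane), so the
partial derivatives of f, or an inseparable descent if they all vanish, contradict
the minimality of F.  Take an irreducible factor f of degree a, the points Q lying
on no other factor, and g of least degree b vanishing on Q and not divisible by f.
The Hilbert function of f bounds b by a + Y, hence all lines meeting Q lie on
f = g = 0 and there are at most ab of them.  A minimal set B of points of Q imposing
all conditions on polynomials of degree < b has at least a b^2 / 6 elements, while a
line contains at most b of them.  Double counting gives A |B| < a b^2 <= 6 |B|, which
is absurd.  Bezout's bound ab itself comes from comparing Hilbert functions in large
degree; it needs f to be prime, hence unique factorization in K[x, y, z].
*)

Require Import Defs.
From HB Require Import structures.
From mathcomp Require Import all_boot all_order all_algebra finmap.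
From mathcomp Require Import boolp classical_sets reals exp.
From mathcomp Require Import mpoly ring lra zify.

Set Implicit Arguments.
Unset Strict Implicit.
Unset Printing Implicit Defensive.

Import Order.TTheory GRing.Theory Num.Theory.

Local Open Scope ring_scope.

(** * Irreducible polynomials are prime *)

Definition divides (R : pzRingType) (a b : R) : Prop := exists c, b = c * a.

(* The last clause states the coprimality of the cofactors as Euclid's lemma. *)
Definition gcd_domain (R : idomainType) : Prop :=
  forall a b : R, a != 0 -> b != 0 ->
  exists d a' b', [/\ a = d * a', b = d * b' &
    forall c, divides a' (b' * c) -> divides a' c].

Section PrimitivePolynomials.

Variable R : idomainType.
Hypothesis gcdR : gcd_domain R.
Implicit Types (p q : {poly R}) (r s : R).

Definition const_divides r p := exists q, p = r *: q.

(* Over a gcd domain this amounts to having unit content; the stronger form passes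
   to factors and detects exact divisibility of coefficients. *)
Definition primitive p := forall r s, const_divides r (s *: p) -> divides r s.

Lemma const_dividesP r p :
  (forall i, divides r p`_i) -> const_divides r p.
Proof.
elim/poly_ind: p => [_|p c IHp rp]; first by exists 0; rewrite scaler0.
have [q Dp]: const_divides r p.
  by apply: IHp => i; have := rp i.+1; rewrite coefD coefMX coefC /= addr0.
have [e De] := rp 0; rewrite coefD coefMX coefC /= add0r in De.
exists (q * 'X + e%:P).
by rewrite De Dp (mulrC e) polyCM -!mul_polyC mulrDr mulrA.
Qed.

Lemma const_divides_coef r p i : const_divides r p -> divides r p`_i.
Proof. by case=> q ->; exists q`_i; rewrite coefZ mulrC. Qed.

Lemma primitive_neq0 p : primitive p -> p != 0.
Proof.
move=> prim_p; apply/eqP=> p0; have [|c /eqP] := prim_p 0 1.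
  by exists 0; rewrite p0 !scaler0.
by rewrite mulr0 oner_eq0.
Qed.

(** Dividing [r] and [s] by their gcd leaves [r'] and [s']. Then [r'] divides every coefficient of
    [s' *: p], hence of [p], so it is a unit. *)
Lemma primitive_unit_content p : p != 0 ->
  (forall r, const_divides r p -> divides r 1) -> primitive p.
Proof.
move=> p0 unit_p r s [q Dsp].
have [s0|s0] := eqVneq s 0; first by exists 0; rewrite s0 mul0r.
have r0: r != 0.
  apply: contraTneq p0 => r0; have /eqP := Dsp.
  by rewrite r0 scale0r scale_poly_eq0 (negPf s0) negbK.
have [d [r' [s' [Dr Ds cop]]]] := gcdR r0 s0.
have d0: d != 0 by apply: contraNneq r0 => d0; rewrite Dr d0 mul0r.
have [|k Dk] := unit_p r'.
  apply: const_dividesP => i; apply: cop; exists q`_i.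
  have /(congr1 (fun z : {poly R} => z`_i)) := Dsp.
  by rewrite !coefZ Dr Ds -!mulrA => /(mulfI d0) ->; rewrite mulrC.
by exists (s' * k); rewrite Dr Ds (mulrC d r') mulrA -(mulrA s') -Dk mulr1 mulrC.
Qed.

(** Horner induction: the content of [p * 'X + c] is the gcd of [c] and the content of [p], and
    coprimality of the cofactors makes the quotient primitive. *)
Lemma primitive_part p : p != 0 -> exists c p', p = c *: p' /\ primitive p'.
Proof.
have prim1 : primitive 1.
  move=> r s [q /(congr1 (fun z : {poly R} => z`_0))].
  by rewrite !coefZ coefC /= mulr1 => ->; exists q`_0; rewrite mulrC.
elim/poly_ind: p => [|p c IHp]; first by rewrite eqxx.
have [->|p0 _] := eqVneq p 0.
  rewrite mul0r add0r => _; exists c, 1; split=> //.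
  by rewrite -mul_polyC mulr1.
have [d [q [Dp prim_q]]] := IHp p0.
have d0: d != 0 by apply: contraNneq p0 => d0; rewrite Dp d0 scale0r.
have [->|c0] := eqVneq c 0.
  exists d, (q * 'X); rewrite addr0 Dp scalerAl; split=> // r s rsq.
  apply: prim_q; apply: const_dividesP => i.
  by have := const_divides_coef i.+1 rsq; rewrite !coefZ coefMX.
have [g [e [f [De Df cop]]]] := gcdR d0 c0.
exists g, (e *: q * 'X + f%:P); split.
  by rewrite Dp De Df scalerDr -scalerA !scalerAl polyCM mul_polyC.
have e0: e != 0 by apply: contraNneq d0 => e0; rewrite De e0 mulr0.
move=> r s rs.
have [s0|s0] := eqVneq s 0; first by exists 0; rewrite s0 mul0r.
have [x Dx]: divides r (s * e).
  apply: prim_q; apply: const_dividesP => i.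
  have := const_divides_coef i.+1 rs.
  by rewrite !coefZ coefD coefMX coefC /= addr0 coefZ mulrA.
have [y Dy]: divides r (s * f).
  have := const_divides_coef 0 rs.
  by rewrite !coefZ coefD coefMX coefC /= add0r.
have [|k Dk] := cop x.
  exists y; apply: (mulfI s0); rewrite mulrA Dy mulrCA Dx.
  by rewrite mulrAC mulrA.
by exists k; apply: (mulIf e0); rewrite Dx Dk mulrAC.
Qed.

(** Gauss's lemma without prime elements. A constant [r] dividing [p * q] divides the product of the
    leading coefficients. Its gcd [e] with that of [p] is a unit by [lead_unit], so [r] divides that
    of [q], and [lead_unit] applies again with the factors exchanged. *)
Lemma primitiveM p q : primitive p -> primitive q -> primitive (p * q).
Proof.
have [n] := ubnP (size p + size q); elim: n p q => // n IHn p q.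
rewrite ltnS => le_n prim_p prim_q.
(* Removing the leading term of [p'], which [e] divides, leaves [c *: p1] with [e] dividing
   [c *: (p1 * q')]. By induction [e] divides [c], hence all of the primitive [p']. *)
have lead_unit p' q' e : (size p' + size q' <= n)%N -> primitive p' ->
    primitive q' -> divides e (lead_coef p') -> const_divides e (p' * q') ->
    divides e 1.
  move=> {}le_n {}prim_p {}prim_q [a Da] [w Dw].
  have Dp: p' = (p' - lead_coef p' *: 'X^((size p').-1)) +
                lead_coef p' *: 'X^((size p').-1) by rewrite subrK.
  have Dl: lead_coef p' *: 'X^((size p').-1) = e *: (a *: 'X^((size p').-1)).
    by rewrite scalerA mulrC -Da.
  have p0 := primitive_neq0 prim_p.
  apply: prim_p; rewrite scale1r.
  have [p10|p10] := eqVneq (p' - lead_coef p' *: 'X^((size p').-1)) 0.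
    by exists (a *: 'X^((size p').-1)); rewrite {1}Dp p10 add0r.
  have [c [p1 [Dp1 prim_p1]]] := primitive_part p10.
  have c0: c != 0 by apply: contraNneq p10 => c0; rewrite Dp1 c0 scale0r.
  have lt_n: (size p1 + size q' < n)%N.
    apply: leq_trans le_n; rewrite ltn_add2r.
    have sp: (size p' > 0)%N by rewrite lt0n size_poly_eq0.
    rewrite -(size_scale p1 c0) -Dp1 -[X in (_ < X)%N](prednK sp) ltnS.
    apply/leq_sizeP => j le_j; rewrite coefB coefZ coefXn.
    have [->|ne] := eqVneq j (size p').-1; first by rewrite mulr1 subrr.
    rewrite mulr0 subr0 nth_default // -(prednK sp) ltn_neqAle le_j andbT.
    by rewrite eq_sym.
  have [|k Dk] := IHn p1 q' lt_n prim_p1 prim_q e c.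
    exists (w - a *: 'X^((size p').-1) * q').
    by rewrite scalerAl -Dp1 mulrBl Dw Dl -scalerAl scalerBr.
  exists (k *: p1 + a *: 'X^((size p').-1)).
  by rewrite scalerDr -Dl scalerA mulrC -Dk -Dp1 -Dp.
have p0 := primitive_neq0 prim_p; have q0 := primitive_neq0 prim_q.
apply: primitive_unit_content => [|r rpq]; first by rewrite mulf_neq0.
have r0: r != 0.
  case: rpq => w Dw; apply: contraNneq (mulf_neq0 p0 q0) => r0.
  by rewrite Dw r0 scale0r.
have lp0: lead_coef p != 0 by rewrite lead_coef_eq0.
have [e [r' [a [Dr Da cop]]]] := gcdR r0 lp0.
have e0: e != 0 by apply: contraNneq r0 => e0; rewrite Dr e0 mul0r.
have [k Dk]: divides e 1.
  apply: (lead_unit p q) => //; first by exists a; rewrite mulrC.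
  by have [w ->] := rpq; exists (r' *: w); rewrite scalerA -Dr.
apply: (lead_unit q p) => //; first by rewrite addnC.
  have [|y Dy] := cop (lead_coef q).
    have := const_divides_coef (size (p * q)).-1 rpq.
    rewrite -/(lead_coef _) lead_coefM Da Dr => -[y].
    rewrite mulrCA -mulrA => /(mulfI e0) ->.
    by exists y.
  exists (y * k); rewrite Dy Dr -mulrA; congr (_ * _).
  by rewrite mulrA -Dk mul1r.
by rewrite mulrC.
Qed.

(** [Pdiv.Idomain.dvdp] is divisibility after scaling [q] by a nonzero constant; Gauss's lemma
    applied to the cofactor cancels that constant. *)
Lemma primitive_dvdp p q : primitive p -> Pdiv.Idomain.dvdp p q -> divides p q.
Proof.
move=> prim_p /Pdiv.Idomain.dvdpP[[c k] /= c0 Dk].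
have [k0|k0] := eqVneq k 0.
  by move/eqP: Dk; rewrite k0 mul0r scale_poly_eq0 (negPf c0) => /eqP->; exists 0;
    rewrite mul0r.
have [ck [k' [Dck prim_k]]] := primitive_part k0.
have [|x Dx] := primitiveM prim_k prim_p (r := c) (s := ck).
  by exists q; rewrite Dk Dck scalerAl.
exists (x *: k'); apply: (@mulfI _ c%:P); first by rewrite polyC_eq0.
by rewrite !mul_polyC Dk Dck Dx -!scalerAl scalerA mulrC.
Qed.

Lemma primitive_divisor p q : primitive (p * q) -> primitive p.
Proof.
move=> prim_pq r s [w Dw]; apply: prim_pq; exists (w * q).
by rewrite scalerAl Dw scalerAl.
Qed.

(** The gcd is the gcd of the contents times the primitive part of a gcd known up to constants.
    Coprimality is checked separately on contents and on primitive parts. *)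
Lemma gcd_domain_poly : gcd_domain {poly R}.
Proof.
move=> p q p0 q0.
have [cp [p' [Dp prim_p]]] := primitive_part p0.
have [cq [q' [Dq prim_q]]] := primitive_part q0.
have cp0: cp != 0 by apply: contraNneq p0 => z; rewrite Dp z scale0r.
have cq0: cq != 0 by apply: contraNneq q0 => z; rewrite Dq z scale0r.
have [d [a [b [Da Db cop]]]] := gcdR cp0 cq0.
have b0: b != 0 by apply: contraNneq cq0 => z; rewrite Db z mulr0.
have g0: Pdiv.Idomain.gcdp p' q' != 0.
  by rewrite Pdiv.Idomain.gcdp_eq0 negb_and primitive_neq0.
have [cg [g [Dg prim_g]]] := primitive_part g0.
have cg0: cg != 0 by apply: contraNneq g0 => z; rewrite Dg z scale0r.
have [u Du]: divides g p'.
  apply: primitive_dvdp => //; rewrite -(Pdiv.Idomain.dvdpZl _ _ cg0) -Dg.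
  exact: Pdiv.Idomain.dvdp_gcdl.
have [w Dw]: divides g q'.
  apply: primitive_dvdp => //; rewrite -(Pdiv.Idomain.dvdpZl _ _ cg0) -Dg.
  exact: Pdiv.Idomain.dvdp_gcdr.
have prim_u: primitive u by apply: (@primitive_divisor u g); rewrite -Du.
have prim_w: primitive w by apply: (@primitive_divisor w g); rewrite -Dw.
have cop_uw: Pdiv.Idomain.coprimep u w.
  rewrite -Pdiv.Idomain.gcdp_eqp1.
  have := Pdiv.Idomain.gcdp_mul2l g u w.
  rewrite ![g * _]mulrC -Du -Dw Dg => gz.
  rewrite -(Pdiv.Idomain.eqp_mul2r _ _ (primitive_neq0 prim_g)) mul1r.
  rewrite Pdiv.Idomain.eqp_sym; apply: Pdiv.Idomain.eqp_trans gz.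
  by rewrite Pdiv.Idomain.eqp_sym Pdiv.Idomain.eqp_scale.
exists (d *: g), (a *: u), (b *: w); split.
- by rewrite Dp Du Da -scalerAl -scalerAr scalerA (mulrC g).
- by rewrite Dq Dw Db -scalerAl -scalerAr scalerA (mulrC g).
move=> c [k Dk].
have [->|c0] := eqVneq c 0; first by exists 0; rewrite mul0r.
have [x Dx]: divides u c.
  apply: (primitive_dvdp prim_u);
    rewrite -(Pdiv.Idomain.Gauss_dvdpr _ cop_uw) -(Pdiv.Idomain.dvdpZr _ _ b0).
  rewrite scalerAl Dk -scalerAr.
  have [->|a0] := eqVneq a 0; first by rewrite scale0r Pdiv.Idomain.dvdp0.
  by rewrite Pdiv.Idomain.dvdpZr // Pdiv.Idomain.dvdp_mull.
have u0 := primitive_neq0 prim_u.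
have x0: x != 0 by apply: contraNneq c0 => z; rewrite Dx z mul0r.
have [cx [x' [Dcx prim_x]]] := primitive_part x0.
have [|y Dy] := cop cx.
  rewrite [_ * cx]mulrC;
    have [|y Dy] := primitiveM prim_w prim_x (r := a) (s := cx * b).
    exists k; apply: (mulIf u0).
    rewrite -[RHS]scalerAl [RHS]scalerAr -Dk Dx Dcx -!mul_polyC polyCM.
    by ring.
  by exists y.
by exists (y *: x'); rewrite Dx Dcx Dy -!scalerAl -scalerAr scalerA.
Qed.

End PrimitivePolynomials.

(** * Passage to several variables, one at a time *)

Lemma muniX (R : nzRingType) n (m : 'X_{1..n.+1}) :
  muni ('X_[m] : {mpoly R[n.+1]}) =
  'X_[[multinom m (widen_ord (leqnSn n) i) | i < n]] *: 'X^(m ord_max).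
Proof. by rewrite muniE msuppX big_seq1 mcoeffX eqxx scale1r. Qed.

Lemma muni_mwiden (R : nzRingType) n (p : {mpoly R[n]}) : muni (mwiden p) = p%:P.
Proof.
rewrite [p]mpolyE [mwiden _]raddf_sum [muni _]raddf_sum [RHS]raddf_sum.
apply: eq_bigr => m _; rewrite [RHS]/= -[X in X = _]/(muni (mwiden (p@_m *: _))).
rewrite mwidenZ mwidenX muniZ muniX mnmwiden_ordmax expr0 alg_polyC.
rewrite -mul_polyC -polyCM mul_mpolyC; congr (_ *: 'X_[_])%:P.
by apply/mnmP => i; rewrite mnmE mnmwiden_widen.
Qed.

(** The inverse evaluates the univariate polynomial at the last variable. *)
Lemma muni_bij (R : comNzRingType) n : bijective (@muni n R).
Proof.
exists (fun P => (mpwiden P).['X_ord_max]) => [p|P].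
  rewrite [p in RHS]mpolyE muniE [mpwiden _]raddf_sum horner_sum.
  apply: eq_bigr => m _; rewrite /= mpwidenZ mwidenZ hornerZ mwidenX.
  rewrite /mpwiden map_polyXn hornerXn -scalerAl mpolyXn -mpolyXD.
  congr (_ *: 'X_[_]); apply/mnmP => i; rewrite mnmDE mulmnE mnm1E.
  case: (unliftP ord_max i) => [j ->|->].
    have -> : lift ord_max j = widen_ord (leqnSn n) j.
      by apply/val_inj; rewrite /= /bump leqNgt ltn_ord.
    rewrite mnmwiden_widen mnmE; case: eqP => [/(congr1 val) /= /eqP|_].
      by rewrite gtn_eqF.
    by rewrite mul0n addn0.
  by rewrite mnmwiden_ordmax eqxx mul1n.
rewrite horner_coef size_map_inj_poly ?mwiden0 //; last exact: inj_mwiden.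
rewrite [muni _]raddf_sum -[RHS]coefK poly_def; apply: eq_bigr => i _.
rewrite coef_map /= muniM muni_mwiden mpolyXn muniX mulmnE mnm1E eqxx mul1n.
rewrite (_ : [multinom _ | _ < n] = 0%MM) ?mpolyX0 ?scale1r ?mul_polyC //.
apply/mnmP => j; rewrite mnmE mnm0E mulmnE mnm1E.
by case: eqP => // /(congr1 val) /= /eqP; rewrite gtn_eqF.
Qed.

Lemma gcd_domain_iso (R S : idomainType) (f : {rmorphism R -> S}) :
  bijective f -> gcd_domain S -> gcd_domain R.
Proof.
case=> g fK gK gcdS a b a0 b0.
have inj_f := can_inj fK.
have [||d [a' [b' [Da Db cop]]]] := gcdS (f a) (f b); try by rewrite raddf_eq0.
exists (g d), (g a'), (g b'); split; try by apply: inj_f; rewrite rmorphM !gK.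
move=> c [k /(congr1 f)]; rewrite !rmorphM !gK => Dk.
have [|l Dl] := cop (f c); first by exists (f k).
by exists (g l); apply: inj_f; rewrite rmorphM !gK.
Qed.

Lemma gcd_domain_mpoly (K : fieldType) n : gcd_domain {mpoly K[n]}.
Proof.
elim: n => [a b a0 b0|n IHn]; last first.
  exact: (gcd_domain_iso (@muni_bij K n) (gcd_domain_poly IHn)).
(* Without variables a nonzero [a] is an invertible constant, so the gcd can be taken to be 1. *)
exists 1, a, b; split; rewrite ?mul1r // => c _.
exists (c * (a@_0%MM)^-1%:MP); rewrite [X in _ * X](nvar0_mpolyC a) -mulrA -mpolyCM.
rewrite mulVf ?mpolyC1 ?mulr1 //; apply: contraNneq a0 => a00.
by rewrite (nvar0_mpolyC a) a00 mpolyC0.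
Qed.

(* msize is the total degree plus one, and 0 for the zero polynomial. *)
Definition mirreducible (K : fieldType) n (f : {mpoly K[n]}) : Prop :=
  (1 < msize f)%N /\
  forall d e, f = d * e -> (msize d <= 1)%N \/ (msize e <= 1)%N.

(** With [f = d * a] and [g = d * b], one of [d] and [a] is a unit. It is not [a], since [f] does
    not divide [g]. So [a] is [f] up to a unit, and [a] divides [v * b], hence [v]. *)
Lemma mirreducible_prime (K : fieldType) n (f g v : {mpoly K[n]}) :
  mirreducible f -> divides f (v * g) -> ~ divides f g -> divides f v.
Proof.
move=> [f1 irr_f] fvg nfg.
have f0: f != 0 by apply: contraTneq f1 => ->; rewrite mmeasure0.
have g0: g != 0 by apply/eqP=> g0; apply: nfg; exists 0; rewrite g0 mul0r.
have unit_cst (d : {mpoly K[n]}) : d != 0 -> (msize d <= 1)%N -> exists e, d * e = 1.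
  move=> d0 /msize1_polyC Dd; exists (d@_0%MM)^-1%:MP.
  rewrite {1}Dd -mpolyCM mulfV //; apply: contraNneq d0 => d00.
  by rewrite Dd d00 mpolyC0.
have [d [a [b [Df Dg cop]]]] := gcd_domain_mpoly f0 g0.
have d0: d != 0 by apply: contraNneq f0 => z; rewrite Df z mul0r.
have a0: a != 0 by apply: contraNneq f0 => z; rewrite Df z mulr0.
have [/(unit_cst _ d0)[e De]|/(unit_cst _ a0)[e De]] := irr_f _ _ Df; last first.
  by case: nfg; exists (b * e); rewrite Dg Df -[d * b]mulr1 -De; ring.
have [k Dk] := fvg.
have [|l Dl] := cop v; last first.
  by exists (l * e); rewrite Dl Df -[l * a]mulr1 -De; ring.
by exists k; apply: (mulfI d0); rewrite mulrA -Dg mulrC Dk Df mulrCA.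
Qed.

(** * Hilbert functions *)

Lemma card_bmnm0 n : #|{: 'X_{1..n < 0}}| = 0%N.
Proof. by apply: eq_card0 => -[]. Qed.

Lemma card_bmnmS n t :
  #|{: 'X_{1..n.+1 < t.+1}}| = (#|{: 'X_{1..n.+1 < t}}| + 'C(t + n, t))%N.
Proof.
have cardS (s : seq 'X_{1..n.+1}) k : uniq s ->
    (forall m, (m \in s) = (mdeg m < k)%N) -> #|{: 'X_{1..n.+1 < k}}| = size s.
  move=> uniq_s mem_s.
  rewrite cardE -[LHS](size_map (@bmnm _ _)); apply: perm_size.
  apply: uniq_perm => //; first by rewrite map_inj_uniq ?enum_uniq //; apply: val_inj.
  move=> m; rewrite mem_s; apply/mapP/idP => [[b _ ->]|lt_m]; first exact: bmdeg.
  by exists (BMultinom lt_m); rewrite ?mem_enum.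
pose sb := [seq s2m t' | t' : t.-tuple 'I_n.+1 <- enum (basis n.+1 t)].
pose s := map (@bmnm n.+1 t) (enum {: 'X_{1..n.+1 < t}}).
have mem_s m : (m \in s) = (mdeg m < t)%N.
  apply/mapP/idP => [[b _ ->]|lt_m]; first exact: bmdeg.
  by exists (BMultinom lt_m); rewrite ?mem_enum.
have -> : #|{: 'X_{1..n.+1 < t}}| = size s by rewrite size_map cardE.
rewrite -size_basis -size_cat; apply: cardS => //.
  rewrite cat_uniq uniq_basis map_inj_uniq ?enum_uniq /= ?andbT; last exact: val_inj.
  by apply/hasPn => m; rewrite -basis_cover mem_s => /eqP->; rewrite ltnn.
by move=> m; rewrite mem_cat mem_s -basis_cover orbC ltnS [RHS]leq_eqVlt.
Qed.

(** The cardinal is [C(t + 2, 3)]; the factor 6 avoids division. *)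
Lemma card_bmnm3 t : (6 * #|{: 'X_{1..3 < t}}| = t * t.+1 * t.+2)%N.
Proof.
elim: t => [|t IHt]; first by rewrite card_bmnm0 !muln0.
rewrite card_bmnmS mulnDr IHt -bin_sub ?leq_addr // addKn addn2.
have := bin_ffact t.+2 2; rewrite !ffactnS ffactn0 /= muln1.
rewrite (_ : 2`! = 2%N) //; nia.
Qed.

Section Coefficients.

Variables (K : fieldType) (n : nat).
Implicit Types p q f : {mpoly K[n]}.

Local Notation N t := #|{: 'X_{1..n < t}}|.

(** Coefficient vectors stand for the polynomials of degree below [t], so that dimension counts
    become matrix ranks. *)
Definition poly_of t (v : 'rV[K]_(N t)) : {mpoly K[n]} :=
  \sum_i v 0 i *: 'X_[bmnm (enum_val i)].

Definition coefs_of t p : 'rV[K]_(N t) := \row_i p@_(bmnm (enum_val i)).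

Lemma poly_of_linear t : linear (@poly_of t).
Proof.
move=> a u v; rewrite /poly_of scaler_sumr -big_split; apply: eq_bigr => i _.
by rewrite !mxE scalerDl scalerA.
Qed.

Lemma coefs_of_linear t : linear (@coefs_of t).
Proof. by move=> a p q; apply/rowP => i; rewrite !mxE mcoeffD mcoeffZ. Qed.

HB.instance Definition _ t := GRing.isLinear.Build K _ _ _ (@poly_of t)
  (@poly_of_linear t).
HB.instance Definition _ t := GRing.isLinear.Build K _ _ _ (@coefs_of t)
  (@coefs_of_linear t).

Lemma poly_ofK t : cancel (@poly_of t) (@coefs_of t).
Proof.
move=> v; apply/rowP => i; rewrite mxE /poly_of raddf_sum (bigD1 i) //=.
rewrite mcoeffZ mcoeffX eqxx mulr1 big1 ?addr0 // => j ne_ji.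
rewrite mcoeffZ mcoeffX; case: eqP; rewrite ?mulr0 // => /val_inj /enum_val_inj.
by move/eqP; rewrite (negPf ne_ji).
Qed.

Lemma coefs_ofK t p : (msize p <= t)%N -> poly_of (coefs_of t p) = p.
Proof.
move=> le_p; rewrite [RHS](mpolywE le_p) /poly_of (reindex enum_rank) /=; last first.
  by apply: onW_bij; apply: enum_rank_bij.
by apply: eq_bigr => m _; rewrite mxE enum_rankK.
Qed.

Lemma msize_poly_of t (v : 'rV_(N t)) : (msize (poly_of v) <= t)%N.
Proof.
apply: leq_trans (msize_sum _ _ _) _; apply/bigmax_leqP => i _.
by apply: leq_trans (msizeZ_le _ _) _; rewrite msizeX bmdeg.
Qed.

End Coefficients.

(** The rank of [f] is at most [n], and its kernel, covered by [g], has dimension at most [k]. *)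
Lemma rank_nullity_le (K : fieldType) m n k (f : {linear 'rV[K]_m -> 'rV[K]_n})
    (g : {linear 'rV[K]_k -> 'rV[K]_m}) :
  (forall u, f u = 0 -> exists w, u = g w) -> (m <= n + k)%N.
Proof.
move=> ker_f; rewrite -leq_subLR.
apply: leq_trans (_ : (m - \rank (lin1_mx f) <= _)%N).
  by rewrite leq_sub2l // rank_leq_col.
rewrite -mxrank_ker; apply: leq_trans (rank_leq_row (lin1_mx g)).
apply: mxrankS; apply/row_subP => i; set u := row i _.
have [|w ->] := ker_f u; last by rewrite -mul_rV_lin1 submxMl.
by apply/eqP; rewrite -mul_rV_lin1 -sub_kermx row_sub.
Qed.

Section Interpolation.

Variables (K : fieldType) (n : nat).
Implicit Types (p f : {mpoly K[n]}) (x : 'rV[K]_n).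

Lemma msize_mul_leq p f t : f != 0 -> (msize (p * f) <= t)%N ->
  (msize p <= t.+1 - msize f)%N.
Proof.
move=> f0; have [->|p0] := eqVneq p 0; first by rewrite mmeasure0.
rewrite msizeM //.
have := mmeasure_poly_eq0 mdeg f; rewrite (negPf f0).
have := mmeasure_poly_eq0 mdeg p; rewrite (negPf p0).
by move: (msize p) (msize f) => a b; lia.
Qed.

(** The kernel of evaluation at [B] consists of multiples of [f]. Since [t.+1 - msize f] is
    [t - deg f] truncated at 0, the difference of the two cardinals is the Hilbert function of
    [f]. *)
Lemma card_le_vanishing f t (B : seq 'rV[K]_n) : f != 0 ->
    (forall p, (msize p <= t)%N -> {in B, forall x, p.@[x 0] = 0} -> divides f p) ->
  (#|{: 'X_{1..n < t}}| <= size B + #|{: 'X_{1..n < t.+1 - msize f}}|)%N.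
Proof.
move=> f0 fB.
pose ev (v : 'rV[K]_#|{: 'X_{1..n < t}}|) := \row_(i < size B) (poly_of v).@[nth 0 B i
  0].
pose mul (w : 'rV[K]_#|{: 'X_{1..n < t.+1 - msize f}}|) := coefs_of t (poly_of w * f).
have lin_ev : linear ev.
  by move=> a u v; apply/rowP => i; rewrite !mxE linearP /= mevalD mevalZ.
have lin_mul : linear mul.
  by move=> a u v; rewrite /mul linearP mulrDl -scalerAl linearP.
pose fev : {linear _ -> _} := HB.pack ev (GRing.isLinear.Build _ _ _ _ ev lin_ev).
pose fmul : {linear _ -> _} := HB.pack mul (GRing.isLinear.Build _ _ _ _ mul lin_mul).
apply: (@rank_nullity_le K _ _ _ fev fmul) => u /= u0.
have [x xB|q Dq] := fB _ (msize_poly_of u).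
  move/rowP/(_ (Ordinal (etrans (index_mem x B) xB))): u0.
  by rewrite !mxE /= nth_index.
exists (coefs_of _ q).
rewrite /fmul /= /mul coefs_ofK -?Dq ?poly_ofK //.
by apply: msize_mul_leq => //; rewrite -Dq msize_poly_of.
Qed.

End Interpolation.

Lemma card_le_vanishing0 (K : fieldType) n t (B : seq 'rV[K]_n.+1) :
    (forall p : {mpoly K[n.+1]}, (msize p <= t)%N ->
       {in B, forall x : 'rV[K]_n.+1, p.@[x 0] = 0} -> p = 0) ->
  (#|{: 'X_{1..n.+1 < t}}| <= size B)%N.
Proof.
(* A power of degree [t] has no nonzero multiple of degree below [t], so the correction term of
   [card_le_vanishing] is 0. *)
move=> B0; pose f : {mpoly K[n.+1]} := 'X_[(U_(ord0) *+ t)%MM].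
have f0: f != 0 by rewrite -mleadc_eq0 /f mleadXm mcoeffX eqxx oner_eq0.
have := card_le_vanishing f0 (t := t) (B := B).
rewrite /f msizeX mdegMn mdeg1 mul1n subnn card_bmnm0 addn0; apply.
by move=> p le_p pB; exists 0; rewrite (B0 p) ?mul0r.
Qed.

(** * Lines on two surfaces *)

Section RestrictionToLine.

Variables (K : fieldType) (n : nat).
Implicit Types (p q f : {mpoly K[n]}) (x v : 'rV[K]_n).

(** Kept as a formal polynomial in the parameter: over a finite field a nonzero restriction can
    vanish at every point of the line. *)
Definition restr x v p : {poly K} :=
  mmap polyC (fun i => (x 0 i)%:P + v 0 i *: 'X) p.

HB.instance Definition _ x v := GRing.RMorphism.copy (restr x v)
  (mmap polyC (fun i => (x 0 i)%:P + v 0 i *: 'X)).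

Lemma restrX x v i : restr x v 'X_i = (x 0 i)%:P + v 0 i *: 'X.
Proof. by rewrite /restr mmapX mmap1U. Qed.

Lemma restrC x v c : restr x v c%:MP = c%:P.
Proof. by rewrite /restr mmapC. Qed.

Lemma restrZ x v c p : restr x v (c *: p) = c *: restr x v p.
Proof. by rewrite /restr mmapZ mul_polyC. Qed.

Lemma restrB x v p q : restr x v (p - q) = restr x v p - restr x v q.
Proof. exact: rmorphB. Qed.

Lemma restrM x v p q : restr x v (p * q) = restr x v p * restr x v q.
Proof. exact: rmorphM. Qed.

Lemma horner_restr x v p t : (restr x v p).[t] = p.@[(x + t *: v) 0].
Proof.
rewrite mevalE /restr /mmap horner_sum; apply: eq_bigr => m _.
rewrite hornerM hornerC /mmap1 horner_prod; congr (_ * _).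
apply: eq_bigr => i _; rewrite horner_exp hornerD hornerC hornerZ hornerX !mxE.
by rewrite mulrC.
Qed.

Lemma size_restr x v p : (size (restr x v p) <= msize p)%N.
Proof.
rewrite /restr /mmap; apply: leq_trans (size_sum _ _ _) _.
apply/bigmax_leqP_seq => m m_p _.
rewrite mul_polyC; apply: leq_trans (size_scale_leq _ _) _.
apply: leq_trans (msize_mdeg_lt m_p); rewrite mdegE /mmap1.
apply: (big_ind2 (fun (P : {poly K}) d => (size P <= d.+1)%N)) => [|P d Q e sP sQ|i _].
- by rewrite size_poly1.
- apply: leq_trans (size_polyMleq _ _) _.
  by move: (size P) (size Q) sP sQ => a b; lia.
elim: (m i) => [|k IHk]; first by rewrite expr0 size_poly1.
rewrite exprS; apply: leq_trans (size_polyMleq _ _) _.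
set l : {poly K} := _ + _ in IHk *; suff: (size l <= 2)%N.
  by move: (size l) (size (l ^+ k)%R) IHk => a b; lia.
apply: leq_trans (size_polyD _ _) _; rewrite geq_max.
by rewrite (leq_trans (size_polyC_leq1 _)) // (leq_trans (size_scale_leq _ _))
  ?size_polyX.
Qed.

(** A coordinate in which [v] is nonzero recovers the parameter of a point, so [S] yields more
    distinct roots than the degree allows. *)
Lemma restr_eq0 x v p (S : seq 'rV[K]_n) : v != 0 -> uniq S ->
    (forall y, y \in S -> (exists t, y = x + t *: v) /\ p.@[y 0] = 0) ->
  (msize p <= size S)%N -> restr x v p = 0.
Proof.
move=> v0 uS S0 le_p.
have [k vk] : exists k, v 0 k != 0 by apply/rV0Pn.
pose c (y : 'rV[K]_n) := (y 0 k - x 0 k) / v 0 k.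
have cE t : c (x + t *: v) = t by rewrite /c !mxE addrAC subrr add0r mulfK.
apply: (@roots_geq_poly_eq0 _ _ (map c S)).
- apply/allP => _ /mapP[y /S0[[t ->] y0] ->].
  by rewrite cE /root horner_restr y0.
- rewrite map_inj_in_uniq // => y z /S0[[t ->] _] /S0[[s ->] _].
  by rewrite !cE => ->.
- by rewrite size_map (leq_trans (size_restr _ _ _)).
Qed.

End RestrictionToLine.

Section LineForms.

Variables (K : fieldType) (n : nat).
Implicit Types (x v y : 'rV[K]_n).

(** These are the 2 by 2 minors of the matrix with rows [v] and [X - x]; together they cut out the
    line. *)
Definition line_form x v (a b : 'I_n) : {mpoly K[n]} :=
  v 0 a *: ('X_b - (x 0 b)%:MP) - v 0 b *: ('X_a - (x 0 a)%:MP).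

Lemma msize_line_form x v a b : (msize (line_form x v a b) <= 2)%N.
Proof.
have lin (c : K) (i : 'I_n) : (msize (c *: ('X_i - (x 0 i)%:MP : {mpoly K[n]}))%R <=
  2)%N.
  apply: leq_trans (msizeZ_le _ _) _; apply: leq_trans (mmeasureD_le _ _ _) _.
  by rewrite geq_max msizeX mdeg1 mmeasureN mmeasureC; case: (_ != 0).
apply: leq_trans (mmeasureD_le _ _ _) _.
by rewrite geq_max mmeasureN !lin.
Qed.

Lemma restr_line_form x v a b : restr x v (line_form x v a b) = 0.
Proof.
rewrite /line_form !(restrB, restrZ) !restrX !restrC !(addrAC _ (_ *: _)) !subrr.
by rewrite !add0r !scalerA mulrC subrr.
Qed.

Lemma line_form_separates x v y : v != 0 -> (forall t, y != x + t *: v) ->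
  exists a b, (line_form x v a b).@[y 0] != 0.
Proof.
move=> v0 ny; have [a va] : exists a, v 0 a != 0 by apply/rV0Pn.
have /rV0Pn[b] : y - x - ((y 0 a - x 0 a) / v 0 a) *: v != 0.
  by rewrite subr_eq0 subr_eq addrC ny.
rewrite !mxE => yb; exists a, b.
rewrite mevalB !mevalZ !mevalB !mevalXU !mevalC.
apply: contra_neq yb => /(congr1 (fun z => z / v 0 a)).
by rewrite mul0r => E; rewrite -[RHS]E; field.
Qed.

End LineForms.

Lemma msizeM_leq (K : fieldType) n (p q : {mpoly K[n]}) :
  (msize (p * q) <= (msize p + msize q).-1)%N.
Proof.
have [->|p0] := eqVneq p 0; first by rewrite mul0r mmeasure0.
have [->|q0] := eqVneq q 0; first by rewrite mulr0 mmeasure0.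
by rewrite msizeM.
Qed.

(** * Bezout's bound for lines on two surfaces *)

Section Bezout.

Variables (K : fieldType) (n : nat) (f g : {mpoly K[n]}).
Variables (N : nat) (x v : 'I_N -> 'rV[K]_n).
Hypothesis irr_f : mirreducible f.
Hypothesis ndiv_fg : ~ divides f g.
Hypothesis v0 : forall i, v i != 0.
Hypothesis distinct : forall i j, i != j ->
  exists s, forall t, x i + s *: v i != x j + t *: v j.
Hypothesis restr_f : forall i, restr (x i) (v i) f = 0.
Hypothesis restr_g : forall i, restr (x i) (v i) g = 0.

(** A product of linear forms, one for each other line, vanishing on that line but not on line
    [i]. *)
Lemma separating_poly i : exists G : {mpoly K[n]}, [/\ (msize G <= N)%N,
  restr (x i) (v i) G != 0 &
  forall j, j != i -> restr (x j) (v j) G = 0].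
Proof.
pose sep j (L : {mpoly K[n]}) := [&& (msize L <= 2)%N, restr (x j) (v j) L == 0 &
  restr (x i) (v i) L != 0].
have /fin_all_exists[L LP] j : exists L, j != i -> sep j L.
  have [->|ji] := eqVneq j i; first by exists 0.
  have [s Ds] : exists s, forall t, x i + s *: v i != x j + t *: v j.
    by apply: distinct; rewrite eq_sym.
  have [a [b ab]] := line_form_separates (v0 j) Ds.
  exists (line_form (x j) (v j) a b) => _; apply/and3P.
  split; rewrite ?msize_line_form ?restr_line_form //.
  by apply: contraNneq ab => r0; rewrite -horner_restr r0 horner0.
exists (\prod_(j | j != i) L j); split.
- apply: leq_trans (_ : (\sum_(j < N | j != i) 1).+1 <= N)%N; last first.
    by rewrite sum1_card cardC1 card_ord prednK // (leq_ltn_trans _ (ltn_ord i)).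
  apply: (big_ind2 (fun (P : {mpoly K[n]}) d => (msize P <= d.+1)%N)).
  + by rewrite mmeasure1.
  + move=> P d Q e sP sQ; apply: leq_trans (msizeM_leq _ _) _.
    by move: (msize P) (msize Q) sP sQ => a b; lia.
  + by move=> j /LP /and3P[].
- rewrite rmorph_prod; apply/prodf_neq0 => j /LP /and3P[_ _ ri]; exact: ri.
- move=> j ji; rewrite (bigD1 j) //= restrM; have /and3P[_ /eqP-> _] := LP j ji.
  by rewrite mul0r.
Qed.

Lemma line_coordinate i : exists k, v i 0 k != 0.
Proof. exact/rV0Pn. Qed.

(** The combinations [p1 * f + p2 * g + \sum_i G i * w i], with [T] free coefficients in each [w i],
    have degree below [t]. Restriction to line [i] kills every term but [G i * w i], so a zero
    combination has [w i = 0]. What remains is a syzygy, which is a multiple of [(- g, f)] because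
    [f] is prime. *)
Lemma postulation_lines t T : (N + T <= t.+1)%N ->
  (#|{: 'X_{1..n < t.+1 - msize f}}| + (#|{: 'X_{1..n < t.+1 - msize g}}| + N * T)
   <= #|{: 'X_{1..n < t}}| + #|{: 'X_{1..n < (t.+1 - msize g).+1 - msize f}}|)%N.
Proof.
move=> le_NT.
have /fin_all_exists[G GP] := separating_poly.
have /fin_all_exists[k kP] := line_coordinate.
have f0: f != 0 by case: irr_f => f1 _; apply: contraTneq f1 => ->; rewrite mmeasure0.
have g0: g != 0 by apply/eqP=> g0; apply: ndiv_fg; exists 0; rewrite g0 mul0r.
(* As [v i] is nonzero in coordinate [k i], a polynomial in that coordinate alone restricts to its
   composition with a polynomial of degree 1, and so is not killed on line [i]. *)
pose w (i : 'I_N) (W : 'M[K]_(N, T)) : {mpoly K[n]} := \sum_(j < T) W i j *: 'X_(k i)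
  ^+ j.
have wD a W W' i : w i (a *: W + W') = a *: w i W + w i W'.
  rewrite /w scaler_sumr -big_split; apply: eq_bigr => j _.
  by rewrite !mxE scalerDl scalerA.
pose A := #|{: 'X_{1..n < t.+1 - msize f}}|;
  pose B := #|{: 'X_{1..n < t.+1 - msize g}}|.
pose Phi (u : 'rV[K]_(A + (B + N * T))) : {mpoly K[n]} :=
  poly_of (lsubmx u) * f + poly_of (lsubmx (rsubmx u)) * g +
  \sum_i G i * w i (vec_mx (rsubmx (rsubmx u))).
have linPhi : linear Phi.
  move=> a u u'; rewrite /Phi !linearP /=.
  under eq_bigr => i _ do rewrite wD mulrDr -scalerAr.
  by rewrite big_split /= -scaler_sumr -!mul_mpolyC; ring.
have msize_w i W : (msize (w i W) <= T)%N.
  apply: leq_trans (mmeasure_sum _ _ _ _) _; apply/bigmax_leqP => j _.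
  apply: leq_trans (msizeZ_le _ _) _.
  by rewrite mpolyXn msizeX mdegMn mdeg1 mul1n.
have msizeG i W : (msize (G i * w i W) <= t)%N.
  apply: leq_trans (msizeM_leq _ _) _; have [lG _ _] := GP i.
  by have := msize_w i W; move: (msize _) (msize _) lG => a b; lia.
have msizePhi u : (msize (Phi u) <= t)%N.
  have msizeM_sub (p h : {mpoly K[n]}) : h != 0 -> (msize p <= t.+1 - msize h)%N ->
      (msize (p * h) <= t)%N.
    have [->|p0] := eqVneq p 0; first by rewrite mul0r mmeasure0.
    move=> h0; have := mmeasure_poly_eq0 mdeg h; rewrite (negPf h0) => hs.
    rewrite msizeM //; have := mmeasure_poly_eq0 mdeg p; rewrite (negPf p0).
    by move: (msize p) (msize h) hs => a b; lia.
  apply: leq_trans (mmeasureD_le _ _ _) _; rewrite geq_max.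
  apply/andP; split; last first.
    by apply: leq_trans (mmeasure_sum _ _ _ _) _; apply/bigmax_leqP.
  apply: leq_trans (mmeasureD_le _ _ _) _.
  by rewrite geq_max !msizeM_sub // msize_poly_of.
pose phi u := coefs_of t (Phi u).
pose psi (s : 'rV[K]_#|{: 'X_{1..n < (t.+1 - msize g).+1 - msize f}}|)
    : 'rV[K]_(A + (B + N * T)) :=
  row_mx (coefs_of _ (- (poly_of s * g))) (row_mx (coefs_of _ (poly_of s * f)) 0).
have linphi : linear phi by move=> a u u'; rewrite /phi linPhi linearP.
have linpsi : linear psi.
  move=> a u u'; rewrite /psi linearP /= !mulrDl -!scalerAl opprD -scalerN !linearP /=.
  by rewrite scale_row_mx scale_row_mx scaler0 !add_row_mx addr0.
pose fphi : {linear _ -> _} := HB.pack phi (GRing.isLinear.Build _ _ _ _ phi linphi).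
pose fpsi : {linear _ -> _} := HB.pack psi (GRing.isLinear.Build _ _ _ _ psi linpsi).
apply: (@rank_nullity_le K _ _ _ fphi fpsi) => u /= phi0.
have Phi0 : Phi u = 0 by rewrite -(coefs_ofK (msizePhi u)) -/(phi u) phi0 linear0.
set W := rsubmx (rsubmx u).
have W0 : vec_mx W = 0.
  apply/matrixP => i j; rewrite [RHS]mxE.
  pose q : {poly K} := \sum_(l < T) vec_mx W i l *: 'X^l.
  pose l : {poly K} := (x i 0 (k i))%:P + v i 0 (k i) *: 'X.
  have restr_w : restr (x i) (v i) (w i (vec_mx W)) = q \Po l.
    rewrite /w /q [LHS]raddf_sum [RHS]raddf_sum; apply: eq_bigr => m _ /=.
    rewrite -[LHS]/(restr _ _ _) restrZ comp_polyZ; congr (_ *: _).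
    rewrite [LHS]rmorphXn [RHS]rmorphXn /= comp_polyX; congr (_ ^+ _).
    exact: restrX.
  have size_l : (1 < size l)%N.
    by rewrite /l addrC size_addl size_scale ?size_polyX ?(leq_ltn_trans
      (size_polyC_leq1 _)).
  have : restr (x i) (v i) (Phi u) = restr (x i) (v i) (G i) * (q \Po l).
    rewrite /Phi [LHS]rmorphD [X in X + _]rmorphD /=.
    rewrite -!/(restr _ _ _) !restrM restr_f restr_g !mulr0 !add0r.
    rewrite [LHS]raddf_sum (bigD1 i) //= -!/(restr _ _ _) restrM restr_w.
    rewrite big1 ?addr0 // => i' ii'.
    have [_ _ Gi'] := GP i'.
    by rewrite -!/(restr _ _ _) restrM Gi' 1?eq_sym // mul0r.
  have [_ Gi _] := GP i.
  rewrite Phi0 [LHS]raddf0 => /esym/eqP; rewrite mulf_eq0 (negPf Gi) /=.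
  rewrite comp_poly_eq0 // => /eqP/(congr1 (fun z : {poly K} => z`_j)).
  rewrite coef0 coef_sum (bigD1 j) //= coefZ coefXn eqxx mulr1.
  rewrite big1 ?addr0 // => m mj; rewrite coefZ coefXn.
  by rewrite [_ == _](_ : _ = false) ?mulr0 //; apply/eqP => /val_inj E;
    rewrite E eqxx in mj.
have WW0 : W = 0 by rewrite -[W]vec_mxK W0 linear0.
set p1 := poly_of (lsubmx u); set p2 := poly_of (lsubmx (rsubmx u)).
have syz : p1 * f + p2 * g = 0.
  rewrite -Phi0 /Phi -/p1 -/p2 -/W W0 big1 ?addr0 // => i _.
  by rewrite /w big1 ?mulr0 // => j _; rewrite mxE scale0r.
have [s Ds] : divides f p2.
  apply: (mirreducible_prime irr_f _ ndiv_fg); exists (- p1).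
  by apply/eqP; rewrite mulNr -addr_eq0 addrC syz.
have Dp1 : p1 = - (s * g).
  by apply: (mulIf f0); apply/eqP; rewrite mulNr -addr_eq0 -syz Ds mulrAC.
exists (coefs_of _ s); rewrite /psi coefs_ofK.
  by rewrite -Dp1 -Ds !poly_ofK -WW0 /W !hsubmxK.
by apply: msize_mul_leq => //; rewrite -Ds msize_poly_of.
Qed.

End Bezout.

(** The mixed second difference of [C(t + 2, 3)] with steps [a] and [b] is
    [a * b * (s + (a + b) / 2 + 1)]. *)
Lemma second_difference_le a b s c1 c2 c3 c4 M :
  (6 * c1 = s * s.+1 * s.+2)%N ->
  (6 * c2 = (s + b) * (s + b).+1 * (s + b).+2)%N ->
  (6 * c3 = (s + a) * (s + a).+1 * (s + a).+2)%N ->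
  (6 * c4 = (s + a + b) * (s + a + b).+1 * (s + a + b).+2)%N ->
  (c2 + (c3 + M) <= c4 + c1)%N ->
  (M <= a * b * (s + a + b).+1)%N.
Proof. 
move=> E1 E2 E3 E4 le_c.
have : (2 * M <= a * b * (2 * s + a + b + 2))%N by lia.
have : (a * b * (2 * s + a + b + 2) <= 2 * (a * b * (s + a + b).+1))%N.
  by rewrite mulnCA leq_mul2l; apply/orP; right; lia.
by lia.
Qed.

Lemma bezout_lines (K : fieldType) (f g : {mpoly K[3]}) N (x v : 'I_N -> 'rV[K]_3) :
  mirreducible f -> ~ divides f g -> (forall i, v i != 0) ->
  (forall i j, i != j -> exists s, forall t, x i + s *: v i != x j + t *: v j) ->
  (forall i, restr (x i) (v i) f = 0) -> (forall i, restr (x i) (v i) g = 0) ->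
  (N <= (msize f).-1 * (msize g).-1)%N.
Proof.
move=> irr_f nfg v0 dist rf rg.
have f1 : (0 < msize f)%N by case: irr_f => /ltnW.
have g1 : (0 < msize g)%N.
  rewrite lt0n mmeasure_poly_eq0; apply/eqP=> g0.
  by apply: nfg; exists 0; rewrite g0 mul0r.
move: (msize f) (msize g) (postulation_lines irr_f nfg v0 dist rf rg) f1 g1.
move=> [//|a] [//|b] post _ _ /=.
rewrite leqNgt; apply/negP => lt_ab.
(* If [a * b < N], then [N * T <= a * b * (N + T)] forces [T <= a * b * N], which this [T] exceeds.
   The summand [a + b] keeps the [s] below a natural number. *)
pose T := (a * b * N + a + b).+1.
have := post (N + T).-1 T; rewrite prednK ?addn_gt0 ?orbT // => /(_ (leqnn _)).
have [s Ds] : exists s, (N + T = (s + a + b).+1)%N.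
  by exists (N + a * b * N)%N; rewrite /T; lia.
rewrite Ds !subSS /= addnK.
rewrite (_ : (s + a + b - a = s + b)%N); last by lia.
have := card_bmnm3 (s + a + b); have := card_bmnm3 (s + a).
have := card_bmnm3 (s + b); have := card_bmnm3 s.
move=> E1 E2 E3 E4; rewrite addnK => le_c.
have leNT : (N * T <= a * b * (N + T))%N.
  by rewrite Ds; apply: (second_difference_le E1 E2 E3 E4).
have : (a * b * T + T <= N * T)%N by rewrite -mulSnr leq_mul2r lt_ab orbT.
rewrite leqNgt => /negP; apply; apply: leq_ltn_trans leNT _.
by rewrite mulnDr addnC ltn_add2l /T ltnS -addnA leq_addr.
Qed.

(** * Tangent planes and singular points *)

Lemma mpoly_ring_ind (K : comNzRingType) n (P : {mpoly K[n]} -> Prop) :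
  (forall c, P c%:MP) -> (forall i, P 'X_i) ->
  (forall p q, P p -> P q -> P (p + q)) ->
  (forall p q, P p -> P q -> P (p * q)) -> forall p, P p.
Proof.
move=> PC PX PD PM p; have P0: P 0 by rewrite -(mpolyC0 n K).
have P1: P 1 by rewrite -(mpolyC1 n K).
rewrite [p]mpolyE; apply: big_ind => // m _.
rewrite -mul_mpolyC; apply: (PM) => //; rewrite mpolyXE_id.
by apply: big_ind => // i _; elim: (m i) => [|k IHk]; rewrite ?expr0 ?exprS //;
  apply: PM.
Qed.

Lemma mpoly_rmorph_eq (K : comNzRingType) n (S : nzRingType)
    (f g : {rmorphism {mpoly K[n]} -> S}) :
  (forall c, f c%:MP = g c%:MP) -> (forall i, f 'X_i = g 'X_i) -> f =1 g.
Proof.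
move=> fgC fgX; apply: mpoly_ring_ind => // p q fp fq.
  by rewrite !rmorphD fp fq.
by rewrite !rmorphM fp fq.
Qed.

Section Gradient.

Variables (K : fieldType) (n : nat).
Implicit Types (p f : {mpoly K[n]}) (x v : 'rV[K]_n).

Lemma deriv_restr x v p :
  (restr x v p)^`() = \sum_i v 0 i *: restr x v p^`M(i).
Proof.
elim/mpoly_ring_ind: p => [c|i|p q Dp Dq|p q Dp Dq].
- by rewrite restrC derivC big1 // => i _; rewrite mderivC rmorph0 scaler0.
- rewrite restrX derivD derivC derivZ derivX add0r (bigD1 i) //=.
  rewrite mderivX mnm1E eqxx scale1r big1 => [|j ji].
    by rewrite addr0 (_ : _ - _ = 0)%MM ?mpolyX0 ?rmorph1 //; apply/mnmP => k;
      rewrite mnmBE mnm0E subnn.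
  by rewrite mderivX mnm1E eq_sym (negPf ji) scale0r rmorph0 scaler0.
- rewrite -[restr _ _ _]/(restr x v (p + q)).
  rewrite [restr _ _ _]rmorphD derivD Dp Dq -big_split; apply: eq_bigr => i _.
  by rewrite /= -scalerDr mderivD; congr (_ *: _); rewrite [RHS]rmorphD.
rewrite restrM derivM Dp Dq mulr_suml mulr_sumr -big_split; apply: eq_bigr => i _.
rewrite mderivM /= -scalerAl -scalerAr -scalerDr; congr (_ *: _).
by rewrite -!restrM [RHS]rmorphD.
Qed.

Definition gradient f x : 'cV[K]_n := \col_i f^`M(i).@[x 0].

(** Differentiate the zero restriction at parameter 0: a line on the surface is tangent to it at
    [x]. *)
Lemma gradient_restr_eq0 f x v : restr x v f = 0 -> v *m gradient f x = 0.
Proof.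
move=> f0; apply/matrixP => i j; rewrite !ord1 [RHS]mxE mxE {i j}.
have := deriv_restr x v f; rewrite f0 deriv0 => /(congr1 (fun z => z.[0])).
rewrite horner0 horner_sum => E; rewrite [RHS]E; apply: eq_bigr => i _.
by rewrite hornerZ horner_restr scale0r addr0 mxE.
Qed.

End Gradient.

(** A nonzero binary form of degree [d] has at most [d] zeros on the projective line; [s] lists
    representatives of distinct zeros. *)
Lemma binary_form_eq0 (K : fieldType) d (c : nat -> K) (s : seq (K * K)) :
    uniq s -> (0, 0) \notin s ->
    {in s &, forall u w, u.1 * w.2 = w.1 * u.2 -> u = w} ->
    {in s, forall u, \sum_(i < d.+1) c i * (u.1 ^+ i * u.2 ^+ (d - i)) = 0} ->
  (d < size s)%N -> forall i, (i <= d)%N -> c i = 0.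
Proof.
move=> uniq_s nz_s prop_s root_s lt_d i le_i.
pose q := \poly_(i < d.+1) c i.
suff q0 : q = 0 by rewrite -(coef0 K i) -q0 coef_poly ltnS le_i.
pose s' := [seq u <- s | u.2 != 0].
apply: (@roots_geq_poly_eq0 _ q [seq u.1 / u.2 | u <- s']).
- apply/allP => y /mapP[u]; rewrite mem_filter => /andP[u2 us] ->.
  apply/rootP; rewrite /q horner_poly; apply: (mulIf (expf_neq0 d u2)).
  rewrite mul0r -[RHS](root_s u us) mulr_suml; apply: eq_bigr => j _.
  rewrite -mulrA; congr (_ * _); rewrite exprMn -mulrA; congr (_ * _).
  have jd : (j <= d)%N by rewrite -ltnS.
  rewrite (_ : u.2 ^+ d = u.2 ^+ j * u.2 ^+ (d - j)); last by rewrite -exprD subnKC.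
  by rewrite exprVn mulKf ?expf_neq0.
- rewrite map_inj_in_uniq ?filter_uniq // => u w.
  rewrite !mem_filter => /andP[u2 us] /andP[w2 ws] E; apply: prop_s => //.
  by apply: (mulIf (invr_neq0 u2)); rewrite mulrAC E mulfK // divfK.
have [all_s|] := boolP (all (fun u => u.2 != 0) s).
  rewrite size_map /s' (all_filterP all_s); apply: leq_trans lt_d; exact: size_poly.
(* A zero at infinity is lost by dehomogenizing, but it kills the top coefficient, so the degree
   also drops by one. *)
rewrite -has_predC => /hasP[u us /=]; rewrite negbK => /eqP u2.
have u1 : u.1 != 0.
  apply: contraNneq nz_s => u1.
  by rewrite (_ : (0, 0) = u) // [RHS]surjective_pairing u1 u2.
have cd : c d = 0.
  have := root_s u us; rewrite big_ord_recr /= subnn mulr1 big1 => [|j _].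
    by rewrite add0r => /eqP; rewrite mulf_eq0 expf_eq0 (negPf u1) andbF orbF => /eqP.
  by rewrite u2 expr0n subn_eq0 leqNgt ltn_ord /= !mulr0.
apply: leq_trans (_ : d <= _)%N.
  apply/leq_sizeP => j; rewrite leq_eqVlt => /predU1P[<-|lt_j].
    by rewrite coef_poly ltnSn.
  by rewrite coef_poly ltnNge lt_j.
rewrite size_map size_filter -ltnS (leq_trans lt_d) //.
rewrite -(count_predC (fun u : K * K => u.2 != 0)) -addn1 leq_add2l.
rewrite (@eq_in_count _ _ (pred1 u)) ?count_uniq_mem ?leq_b1 // => w ws /=.
rewrite negbK; apply/eqP/eqP => [w2|->//].
by apply: prop_s; rewrite // u2 w2 !mulr0.
Qed.

(** * Affine substitutions and tangent planes *)

Section AffineSubstitution.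

Variables (K : fieldType) (n : nat).
Implicit Types (p : {mpoly K[n]}) (x y w : 'rV[K]_n) (M N : 'M[K]_n).

(** The coordinates of [x + X M], vectors being rows; [aff x M] is thus the pullback along this
    affine map. *)
Definition aff_coord x M i : {mpoly K[n]} := (x 0 i)%:MP + \sum_k M k i *: 'X_k.

Definition aff x M p : {mpoly K[n]} := mmap (@mpolyC n K) (aff_coord x M) p.

HB.instance Definition _ x M := GRing.RMorphism.copy (aff x M)
  (mmap (@mpolyC n K) (aff_coord x M)).

Lemma affC x M c : aff x M c%:MP = c%:MP.
Proof. by rewrite /aff mmapC. Qed.

Lemma affX x M i : aff x M 'X_i = aff_coord x M i.
Proof. by rewrite /aff mmapX mmap1U. Qed.

Lemma affM x M p q : aff x M (p * q) = aff x M p * aff x M q.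
Proof. exact: rmorphM. Qed.

Lemma affZ x M c p : aff x M (c *: p) = c *: aff x M p.
Proof. by rewrite -!mul_mpolyC affM affC. Qed.

Lemma aff_affE x M y N p : aff y N (aff x M p) = aff (x + y *m M) (N *m M) p.
Proof.
apply: (mpoly_rmorph_eq (f := aff y N \o aff x M)) => [c|i] /=; first by rewrite !affC.
rewrite !affX /aff_coord [LHS]rmorphD /= -!/(aff _ _ _) affC [X in _ + X = _]raddf_sum
  /=.
under eq_bigr => k _ do rewrite -/(aff _ _ _) affZ affX /aff_coord scalerDr scaler_sumr.
rewrite big_split /= addrA exchange_big /=; congr (_ + _).
  rewrite !mxE mpolyCD raddf_sum; congr (_ + _); apply: eq_bigr => k _.
  by rewrite /= mpolyCM mulrC mul_mpolyC.
apply: eq_bigr => k _; rewrite mxE scaler_suml; apply: eq_bigr => l _.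
by rewrite scalerA mulrC.
Qed.

Lemma aff_id p : aff 0 1%:M p = p.
Proof.
apply: (mpoly_rmorph_eq (f := aff 0 1%:M) (g := idfun)) => [c|i] /=; first exact: affC.
rewrite affX /aff_coord mxE mpolyC0 add0r (bigD1 i) //= mxE eqxx scale1r.
by rewrite big1 ?addr0 // => k ki; rewrite mxE (negPf ki) scale0r.
Qed.

Lemma affK x M p : M \in unitmx ->
  aff (- (x *m invmx M)) (invmx M) (aff x M p) = p.
Proof. by move=> uM; rewrite aff_affE mulNmx mulmxKV // subrr mulVmx // aff_id. Qed.

Lemma restr_aff y w x M p : restr y w (aff x M p) = restr (x + y *m M) (w *m M) p.
Proof.
apply: (mpoly_rmorph_eq (f := restr y w \o aff x M)) => [c|i] /=.
  by rewrite affC !restrC.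
rewrite affX restrX [LHS]rmorphD /= -!/(restr _ _ _) restrC [X in _ + X = _]raddf_sum
  /=.
under eq_bigr => k _ do rewrite -/(restr _ _ _) restrZ restrX scalerDr.
rewrite big_split /= addrA; congr (_ + _).
  rewrite !mxE polyCD raddf_sum; congr (_ + _); apply: eq_bigr => k _.
  by rewrite /= polyCM mulrC mul_polyC.
rewrite mxE scaler_suml; apply: eq_bigr => k _; by rewrite scalerA mulrC.
Qed.

Lemma msize_aff x M p : (msize (aff x M p) <= msize p)%N.
Proof.
rewrite /aff /mmap; apply: leq_trans (mmeasure_sum _ _ _ _) _.
apply/bigmax_leqP_seq => m m_p _; rewrite mul_mpolyC.
apply: leq_trans (msizeZ_le _ _) _; apply: leq_trans (msize_mdeg_lt m_p).
rewrite mdegE /mmap1.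
apply: (big_ind2 (fun (P : {mpoly K[n]}) d => (msize P <= d.+1)%N)) => [|P d Q e sP
  sQ|i _].
- by rewrite mmeasure1.
- apply: leq_trans (msizeM_leq _ _) _.
  by move: (msize P) (msize Q) sP sQ => a b; lia.
elim: (m i) => [|k IHk]; first by rewrite expr0 mmeasure1.
rewrite exprS; apply: leq_trans (msizeM_leq _ _) _.
set l := aff_coord x M i in IHk *; suff: (msize l <= 2)%N.
  by move: (msize l) (msize (l ^+ k)%R) IHk => a b; lia.
apply: leq_trans (mmeasureD_le _ _ _) _; rewrite geq_max mmeasureC.
rewrite (leq_trans (leq_b1 _)) //; apply: leq_trans (mmeasure_sum _ _ _ _) _.
by apply/bigmax_leqP => j _; rewrite (leq_trans (msizeZ_le _ _)) // msizeX mdeg1.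
Qed.

End AffineSubstitution.

Lemma divides_mpolyX (K : fieldType) n (p : {mpoly K[n]}) (i : 'I_n) :
  (forall m : 'X_{1..n}, m i = 0%N -> p@_m = 0) -> divides 'X_i p.
Proof.
move=> p0; exists (\sum_(m <- msupp p) p@_m *: 'X_[(m - U_(i))%MM]).
rewrite {1}[p]mpolyE mulr_suml !big_seq; apply: eq_bigr => m.
rewrite mcoeff_msupp => pm; rewrite -scalerAl -mpolyXD submK // lep1mP.
by apply: contraNneq pm => /p0->.
Qed.

(** The Gaussian decomposition of the rank one row [a^T] supplies the matrix. It will turn the plane
    orthogonal to [a] into a coordinate plane. *)
Lemma exists_unitmx_col (K : fieldType) n (a : 'cV[K]_n.+1) : a != 0 ->
  exists2 M, M \in unitmx & exists2 c, c != 0 & M *m a = c *: delta_mx 0 0.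
Proof.
move=> a0; exists (invmx (row_ebase a^T)^T).
  by rewrite unitmx_inv unitmx_tr row_ebase_unit.
have Da : a = (row_ebase a^T)^T *m (pid_mx (\rank a^T) *m (col_ebase a^T)^T).
  apply: trmx_inj; rewrite !trmx_mul !trmxK tr_pid_mx.
  by rewrite -[LHS](mulmx_ebase a^T).
have ra : \rank a^T = 1%N.
  by apply/eqP; rewrite eqn_leq rank_leq_row lt0n mxrank_eq0 trmx_eq0 a0.
have ec : (col_ebase a^T)^T = ((col_ebase a^T) 0 0)%:M.
  by apply/matrixP => i j; rewrite !ord1 !mxE mulr1n.
exists (col_ebase a^T 0 0).
  have := col_ebase_unit a^T; rewrite unitmxE unitfE; apply: contraNneq => c0.
  by rewrite -det_tr ec c0 det_scalar expr1.
rewrite {2}Da mulKmx ?unitmx_tr ?row_ebase_unit //.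
rewrite ra ec mul_mx_scalar; congr (_ *: _).
by apply/matrixP => i j; rewrite !mxE !ord1 /= andbC; case: i => -[].
Qed.

Lemma coef_restr0 (K : fieldType) n (w : 'rV[K]_n) (p : {mpoly K[n]}) d :
  (restr 0 w p)`_d =
  \sum_(m <- msupp p | mdeg m == d) p@_m * \prod_i w 0 i ^+ m i.
Proof.
rewrite /restr /mmap coef_sum [RHS]big_mkcond; apply: eq_bigr => m _.
have -> : mmap1 (fun i => ((0 : 'rV[K]_n) 0 i)%:P + w 0 i *: 'X) m =
    (\prod_i w 0 i ^+ m i) *: 'X^(mdeg m).
  rewrite /mmap1 mdegE -prodrXr -mul_polyC rmorph_prod -big_split.
  by apply: eq_bigr => i _; rewrite mxE add0r exprZn -mul_polyC.
rewrite mul_polyC !coefZ coefXn eq_sym.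
by case: eqP; rewrite ?mulr1 ?mulr0.
Qed.

Section PlaneFactor.

Variable K : fieldType.
Implicit Types (f : {mpoly K[3]}) (x y v w : 'rV[K]_3) (a : 'cV[K]_3).

Let i1 : 'I_3 := Ordinal (isT : 1 < 3)%N.
Let i2 : 'I_3 := Ordinal (isT : 2 < 3)%N.

Let mnm12 i j : 'X_{1..3} := (U_(i1) *+ i + U_(i2) *+ j)%MM.

Let mnm12E i j : mnm12 i j =1 tnth [tuple 0; i; j]%N.
Proof.
move=> k; rewrite mnmDE !mulmnE !mnm1E.
by case: k => [[|[|[|//]]] lt_k]; rewrite -!val_eqE /= /tnth /= ?mul0n ?mul1n ?addn0.
Qed.

Let mnm12_surj (m : 'X_{1..3}) : m 0 = 0%N -> m = mnm12 (m i1) (m i2).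
Proof.
move=> m0; apply/mnmP => k; rewrite mnm12E.
case: k => [[|[|[|//]]] lt_k]; rewrite /tnth /=; first rewrite -[RHS]m0.
all: by congr (fun_of_multinom m _); apply: val_inj.
Qed.

Let ord3_sum (F : 'I_3 -> nat) : (\sum_i F i = F 0%R + F i1 + F i2)%N.
Proof.
rewrite !big_ord_recl big_ord0 addn0 addnA.
by congr (_ + F _ + F _)%N; apply: val_inj.
Qed.

(** Only monomials free of [X_0] survive, so the homogeneous part of degree [d] becomes a binary
    form in the other two coordinates. *)
Lemma coef_restr_plane f w d : w 0 0 = 0 ->
  (restr 0 w f)`_d =
  \sum_(i < d.+1) f@_(mnm12 i (d - i)) * (w 0 i1 ^+ i * w 0 i2 ^+ (d - i)).
Proof.
move=> w0; rewrite coef_restr0.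
pose mon (m : 'X_{1..3}) := \prod_i w 0 i ^+ m i.
have monE i j : mon (mnm12 i j) = w 0 i1 ^+ i * w 0 i2 ^+ j.
  rewrite /mon !big_ord_recl big_ord0 mulr1 !mnm12E /tnth /= expr0 mul1r.
  by congr (w 0 _ ^+ _ * w 0 _ ^+ _); apply: val_inj.
transitivity (\sum_(i < d.+1) \sum_(m <- msupp f | m == mnm12 i (d - i)) f@_m * mon m).
  rewrite (exchange_big_dep predT) //= big_mkcond; apply: eq_bigr => m _.
  have [m0|m0] := eqVneq (m 0) 0%N; last first.
    have mon0 : mon m = 0 by rewrite /mon big_ord_recl w0 expr0n (negPf m0) mul0r.
    rewrite -/(mon m) mon0 mulr0 if_same big1 //.
  have Dm : mdeg m = (m i1 + m i2)%N by rewrite mdegE ord3_sum m0.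
  have [Ed|Ed] := eqVneq.
    have lt_m : (m i1 < d.+1)%N by rewrite ltnS -Ed Dm leq_addr.
    rewrite (big_pred1 (Ordinal lt_m)) // => i; apply/eqP/eqP => [E|->].
      by apply: val_inj; rewrite /= E mnm12E.
    by rewrite /= [LHS]mnm12_surj // -Ed Dm addKn.
  rewrite big_pred0 // => i; apply: contraNF Ed => /eqP E.
  by rewrite Dm E !mnm12E /tnth /= subnKC // -ltnS.
apply: eq_bigr => i _; rewrite -monE.
have [mf|mf] := boolP (mnm12 i (d - i) \in msupp f).
  rewrite -big_filter filter_pred1_uniq ?msupp_uniq // big_seq1 //.
rewrite (memN_msupp_eq0 mf) mul0r big1_seq // => m /andP[/eqP-> mf'].
by rewrite mf' in mf.
Qed.

(* Up to an affine substitution the plane is a coordinate plane, on which f is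
   a sum of binary forms, each of degree less than its number of roots. *)
Lemma tangent_plane_divides f x a (s : seq 'rV[K]_3) :
    a != 0 -> uniq s ->
    {in s &, forall v w c, v = c *: w -> v = w} ->
    {in s, forall v, [/\ v != 0, v *m a = 0 & restr x v f = 0]} ->
    (msize f <= size s)%N ->
  exists L : {mpoly K[3]}, [/\ divides L f, L.@[x 0] = 0 &
    forall y, L.@[y 0] = 0 -> (y - x) *m a = 0].
Proof.
move=> a0 uniq_s prop_s s0 le_s.
have [M uM [c c0 Ma]] := exists_unitmx_col a0.
pose f' := aff x M f.
have Ea : invmx M *m delta_mx 0 0 = c^-1 *: a.
  by apply: (canLR (mulKmx uM)); rewrite -scalemxAr Ma scalerA mulVf // scale1r.
have coord0 v : (v *m invmx M) 0 0 = c^-1 * (v *m a) 0 0.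
  have := congr1 (fun A : 'M_1 => A 0 0) (colE 0 (v *m invmx M)).
  by rewrite -mulmxA Ea -scalemxAr !mxE => ->.
pose w v := v *m invmx M.
have wM v : w v *m M = v by rewrite /w mulmxKV.
have w_inj : injective w by move=> v v' E; rewrite -(wM v) E wM.
have w0 v : v *m a = 0 -> w v 0 0 = 0 by move=> va0; rewrite coord0 va0 mxE mulr0.
have wE v w' : w v 0 0 = 0 -> w' 0 0 = 0 -> w v 0 i1 = w' 0 i1 ->
  w v 0 i2 = w' 0 i2 -> w v = w'.
  move=> v0 v'0 e1 e2; apply/rowP => -[[|[|[|//]]] lt_k].
  - by transitivity (w v 0 0); [|rewrite v0 -v'0]; congr (fun_of_matrix _ _ _);
    apply: val_inj.
  - by transitivity (w v 0 i1); [|rewrite e1]; congr (fun_of_matrix _ _ _);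
    apply: val_inj.
  - by transitivity (w v 0 i2); [|rewrite e2]; congr (fun_of_matrix _ _ _);
    apply: val_inj.
have z0 k : (0 : 'rV[K]_3) 0 k = 0 by rewrite mxE.
have scE t (u : 'rV[K]_3) k : (t *: u) 0 k = t * u 0 k by rewrite mxE.
(* Divisibility of [f'] by [X_0] means that no monomial free of [X_0] occurs. In each degree these
   form a binary form vanishing at the transformed directions of [s]. *)
have f'0 (m : 'X_{1..3}) : m 0 = 0%N -> f'@_m = 0.
  move=> m0; have Dm : mdeg m = (m i1 + m i2)%N by rewrite mdegE ord3_sum m0.
  have [le_d|lt_d] := leqP (msize f') (mdeg m).
    by apply/eqP; rewrite mcoeff_eq0 msize_mdeg_ge.
  pose c' i := f'@_(mnm12 i (mdeg m - i)).
  have -> : f'@_m = c' (m i1) by rewrite /c' Dm addKn -mnm12_surj.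
  apply: (binary_form_eq0 (d := mdeg m) (s := [seq (w v 0 i1, w v 0 i2) | v <- s])).
  - rewrite map_inj_in_uniq // => v v' vs v's [e1 e2]; apply: w_inj.
    have [_ /w0 v0 _] := s0 v vs; have [_ /w0 v'0 _] := s0 v' v's.
    exact: wE.
  - apply/mapP => -[v vs [e1 e2]]; have [+ /w0 v0 _] := s0 v vs; case/eqP.
    by rewrite -(wM v) (_ : w v = 0) ?mul0mx //; apply: wE; rewrite ?z0.
  - move=> _ _ /mapP[v vs ->] /mapP[v' v's ->] /= E.
    have [nz_v /w0 v0 _] := s0 v vs; have [nz_v' /w0 v'0 _] := s0 v' v's.
    suff [t Dt] : exists t, v = t *: v' by rewrite (prop_s v v' vs v's t Dt).
    suff [t Dt] : exists t, w v = t *: w v'.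
      by exists t; rewrite -(wM v) Dt -scalemxAl wM.
    have [z1|nz1] := eqVneq (w v' 0 i1) 0; last first.
      exists (w v 0 i1 / w v' 0 i1); apply: wE; rewrite ?scE ?v'0 ?mulr0 ?divfK //.
      by rewrite mulrAC E mulrAC divff // mul1r.
    have nz2 : w v' 0 i2 != 0.
      apply: contraNneq nz_v' => z2; by rewrite -(wM v') (_ : w v' = 0) ?mul0mx //;
        apply: wE; rewrite ?z0.
    exists (w v 0 i2 / w v' 0 i2); apply: wE; rewrite ?scE ?v'0 ?mulr0 ?divfK //.
    by rewrite z1 mulr0; apply: (mulIf nz2); rewrite E z1 !mul0r.
  - move=> _ /mapP[v vs ->] /=; have [_ /w0 v0 rf] := s0 v vs.
    rewrite -(coef_restr_plane _ _ v0) /f' restr_aff mul0mx addr0 wM rf.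
    exact: coef0.
  - rewrite size_map; apply: leq_trans le_s; apply: leq_trans lt_d _.
    exact: msize_aff.
  - by rewrite Dm leq_addr.
pose L := aff (- (x *m invmx M)) (invmx M) 'X_0.
have LE y : L.@[y 0] = c^-1 * ((y - x) *m a) 0 0.
  rewrite -coord0 mulmxBl /L affX /aff_coord mevalD mevalC mxE addrC !mxE.
  rewrite raddf_sum; congr (_ - _); apply: eq_bigr => k _.
  by rewrite /= mevalZ mevalXU mulrC.
exists L; split.
- have [q Dq] := divides_mpolyX f'0; exists (aff (- (x *m invmx M)) (invmx M) q).
  by rewrite -affM -Dq affK.
- by rewrite LE subrr mul0mx mxE mulr0.
- move=> y /eqP; rewrite LE mulf_eq0 invr_eq0 (negPf c0) => /eqP ya.
  by apply/matrixP => i j; rewrite !ord1 ya mxE.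
Qed.

End PlaneFactor.

(* In characteristic p such an f is a polynomial in the p-th powers of the
   variables; its coefficients are a linear relation between the p-th powers of
   the values of the monomials, and Frobenius preserves the rank of a matrix. *)
Lemma inseparable_descent (K : fieldType) n (f : {mpoly K[n]}) (Q : seq 'rV[K]_n) :
    (1 < msize f)%N -> (forall i, f^`M(i) = 0) ->
    {in Q, forall x : 'rV[K]_n, f.@[x 0] = 0} ->
  exists G : {mpoly K[n]}, [/\ G != 0, (msize G < msize f)%N &
    {in Q, forall x : 'rV[K]_n, G.@[x 0] = 0}].
Proof.
move=> f1 df0 fQ.
(* Vanishing derivatives make every exponent zero in [K]; as [f] is not constant, the characteristic
   is positive and divides all exponents. *)
have expo0 m i : m \in msupp f -> (m i)%:R = 0 :> K.
  rewrite mcoeff_msupp => fm; have [->//|m_i] := eqVneq (m i) 0%N.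
  have /(congr1 (mcoeff (m - U_(i))%MM)) := df0 i.
  rewrite mcoeff_deriv submK ?lep1mP // mnmBE mnm1E eqxx mcoeff0 subn1 prednK ?lt0n //.
  by move=> E; apply: (mulfI fm); rewrite mulr_natr E mulr0.
have f0 : f != 0 by apply: contraTneq f1 => ->; rewrite mmeasure0.
have [p pK] : exists p, p \in [pchar K].
  have m_f := mlead_supp f0.
  have [i m_i] : exists i, mlead f i != 0%N.
    apply/existsP; apply: contraLR f1; rewrite negb_exists => /forallP m0.
    rewrite -mlead_deg // -leqNgt ltnS leqn0 mdegE sum_nat_eq0.
    by apply/forallP => i /=; have := m0 i; rewrite negbK.
  have /eqP mi0 := expo0 _ i m_f; have mi_gt0 : (0 < mlead f i)%N by rewrite lt0n.
  by have [p pK] := natf0_pchar mi_gt0 mi0; exists p.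
have p_pr := pcharf_prime pK; have p_gt0 := prime_gt0 p_pr.
pose t := ((msize f).-1 %/ p).+1.
pose N := #|{: 'X_{1..n < t}}|.
pose mon (i : 'I_N) : 'X_{1..n} := bmnm (enum_val i).
pose M0 : 'M[K]_(N, size Q) := \matrix_(i, j) ('X_[mon i] : {mpoly K[n]}).@[nth 0 Q j
  0].
pose M := map_mx (pFrobenius_aut pK) M0.
pose c : 'rV[K]_N := \row_i f@_(mon i *+ p)%MM.
have Df : f = \sum_i c 0 i *: 'X_[(mon i *+ p)%MM].
  apply/mpolyP => m; rewrite raddf_sum /=.
  have [fm|fm] := eqVneq (f@_m) 0.
    rewrite fm big1 // => i _; rewrite mcoeffZ mcoeffX mxE.
    by case: eqP => [->|_]; rewrite ?fm ?mul0r ?mulr0.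
  have m_f : m \in msupp f by rewrite mcoeff_msupp.
  pose m' : 'X_{1..n} := [multinom m i %/ p | i < n].
  have Dm : m = (m' *+ p)%MM.
    apply/mnmP => i; rewrite mulmnE mnmE divnK //.
    by rewrite (dvdn_pcharf pK); apply/eqP/expo0.
  have lt_m' : (mdeg m' < t)%N.
    rewrite ltnS leq_divRL // -mdegMn -Dm -ltnS prednK ?msize_mdeg_lt //.
    by rewrite (ltn_trans _ f1).
  have DI : mon (enum_rank (BMultinom lt_m')) = m' by rewrite /mon enum_rankK.
  rewrite (bigD1 (enum_rank (BMultinom lt_m'))) //= mcoeffZ mcoeffX mxE DI -Dm eqxx
    mulr1.
  rewrite big1 ?addr0 // => i ne_i; rewrite mcoeffZ mcoeffX.
  case: eqP => [E|_]; rewrite ?mulr0 //; case/eqP: ne_i.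
  apply: enum_val_inj; rewrite enum_rankK; apply: val_inj => /=; apply/mnmP => k.
  move/mnmP/(_ k): E; rewrite {1}Dm !mulmnE => /eqP.
  by rewrite eqn_pmul2r // => /eqP.
have cM : c *m M = 0.
  apply/rowP => j; rewrite [RHS]mxE -[RHS](fQ (nth 0 Q j)) ?mem_nth // [in RHS]Df.
  rewrite mxE raddf_sum; apply: eq_bigr => i _; rewrite /= mevalZ !mxE; congr (_ * _).
  by rewrite -mpolyXn [RHS]rmorphXn pFrobenius_autE.
have c0 : c != 0.
  apply: contraNneq f0 => c0; rewrite Df big1 // => i _.
  by rewrite c0 mxE scale0r.
have rk : (\rank M0 < N)%N.
  rewrite -(mxrank_map (pFrobenius_aut pK)) -/M ltn_neqAle rank_leq_row andbT.
  apply: contra c0 => /eqP rk; rewrite -(mul0mx _ M) in cM.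
  have /row_free_inj inj : row_free M by rewrite /row_free rk.
  by rewrite (inj _ _ _ cM).
have [c' c'0 c'M] : exists2 c' : 'rV_N, c' != 0 & c' *m M0 = 0.
  have : kermx M0 != 0 by rewrite -mxrank_eq0 mxrank_ker subn_eq0 -ltnNge.
  by move/rowV0Pn => [u /sub_kermxP uM u0]; exists u.
exists (poly_of c'); split.
- apply: contraNneq c'0 => G0; rewrite -(poly_ofK c') G0 linear0 //.
- apply: leq_ltn_trans (msize_poly_of c') _.
  have := prime_gt1 p_pr; rewrite /t; move: (msize f) f1 => [|[|d]] // _ p1.
  by rewrite /= ltnS ltn_Pdiv.
- move=> x xQ; move/rowP/(_ (Ordinal (etrans (index_mem x Q) xQ))): c'M.
  rewrite [RHS]mxE => <-; rewrite mxE /poly_of raddf_sum; apply: eq_bigr => i _.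
  by rewrite /= mevalZ mxE /= nth_index.
Qed.

(** * Lines, planes and incidences *)

Section Lines.

Variable K : fieldType.
Implicit Types (l : set 'rV[K]_3) (p q v x : 'rV[K]_3).

Lemma line_direction l : is_line l ->
  exists2 v, v != 0 & forall p, p \in l ->
    l = [set q | exists t, q = p + t *: v]%classic.
Proof.
move=> [x [U [dimU ->]]].
have [v v0 DU] : exists2 v, v != 0 & U = <[v]>%VS.
  exists (vpick U); first by rewrite vpick0 -dimv_eq0 dimU.
  apply/esym/eqP; rewrite eqEdim -memvE memv_pick dimU dim_vline.
  by rewrite vpick0 -dimv_eq0 dimU.
exists v => // p; rewrite inE /= DU => /vlineP[t Dt].
apply/seteqP; split => q /=.
  move=> /vlineP[s Ds]; exists (s - t).
  by rewrite scalerBl -Ds -Dt opprB (addrC p) -addrA !subrK.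
move=> [s ->]; apply/vlineP; exists (s + t).
by rewrite scalerDl -Dt addrAC addrC.
Qed.

(** A line is a bare set, so a direction serving all its points has to be chosen; 0 is returned when
    there is none. *)
Definition dir l : 'rV[K]_3 :=
  xget 0 [set v | v != 0 /\ forall p, p \in l ->
    l = [set q | exists t, q = p + t *: v]%classic]%classic.

Lemma dirP l : is_line l ->
  dir l != 0 /\ forall p, p \in l -> l = [set q | exists t, q = p + t *: dir l]%classic.
Proof.
move=> /line_direction[v v0 Dl]; rewrite /dir.
by case: xgetP => [w _ [w0 Dw]|/(_ v)[]] //; split.
Qed.

Lemma dir_neq0 l : is_line l -> dir l != 0.
Proof. by case/dirP. Qed.

Lemma in_line l p q : is_line l -> p \in l ->
  (q \in l) <-> exists t, q = p + t *: dir l.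
Proof. by move=> /dirP[_ Dl] /Dl E; rewrite {1}E; split; rewrite inE. Qed.

Lemma eq_line l l' p c : is_line l -> is_line l' -> p \in l -> p \in l' ->
  dir l = c *: dir l' -> l = l'.
Proof.
move=> ll ll' pl pl' Dd; have c0 : c != 0.
  by apply: contraNneq (dir_neq0 ll) => c0; rewrite Dd c0 scale0r.
apply/seteqP; split=> q /mem_set ql; apply/set_mem; move: ql.
  move/(in_line _ ll pl) => [t ->]; apply/(in_line _ ll' pl').
  by exists (t * c); rewrite Dd scalerA.
move/(in_line _ ll' pl') => [t ->]; apply/(in_line _ ll pl).
by exists (t / c); rewrite Dd scalerA divfK.
Qed.

Lemma eq_line2 l l' p q : is_line l -> is_line l' -> p != q ->
  p \in l -> q \in l -> p \in l' -> q \in l' -> l = l'.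
Proof.
move=> ll ll' npq pl ql pl' ql'.
have /(in_line _ ll pl)[t Dt] := ql; have /(in_line _ ll' pl')[s Ds] := ql'.
have t0 : t != 0 by apply: contraNneq npq => t0; rewrite Dt t0 scale0r addr0.
apply: (@eq_line l l' p (t^-1 * s)) => //; apply: (scalerI t0).
by rewrite scalerA mulrA divff // mul1r; apply: (addrI p); rewrite -Dt -Ds.
Qed.

End Lines.

Lemma line_exists_notin (K : fieldType) (l l' : set 'rV[K]_3) p :
  is_line l -> is_line l' -> l <> l' -> p \in l ->
  exists s, p + s *: dir l \notin l'.
Proof.
move=> ll ll' nll' pl; apply: contrapT => all_l'.
have in_l' s : p + s *: dir l \in l'.
  by apply/negPn/negP => s_l'; apply: all_l'; exists s.
apply: nll'; apply: (@eq_line2 _ l l' p (p + dir l)) => //.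
- by rewrite -subr_eq0 opprD addNKr oppr_eq0 dir_neq0.
- by apply/(in_line _ ll pl); exists 1; rewrite scale1r.
- by have := in_l' 0; rewrite scale0r addr0.
- by have := in_l' 1; rewrite scale1r.
Qed.

Lemma msize_mderiv (K : fieldType) n (f : {mpoly K[n]}) i :
  f != 0 -> (msize f^`M(i) < msize f)%N.
Proof.
move=> f0; rewrite [X in (X < _)%N]msizeE.
apply: leq_ltn_trans (_ : (msize f).-1 < _)%N;
  last by rewrite prednK // lt0n mmeasure_poly_eq0.
apply/bigmax_leqP_seq => m; rewrite mcoeff_msupp mcoeff_deriv => fm _.
have : (m + U_(i))%MM \in msupp f.
  by rewrite mcoeff_msupp; apply: contraNneq fm => ->; rewrite mul0rn.
by move/msize_mdeg_lt; rewrite mdegD mdeg1 addn1; case: (msize f).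
Qed.

Lemma in_lines_through (K : fieldType) (L : {fset set 'rV[K]_3}) (x : 'rV[K]_3) l :
  (l \in lines_through L x) = (l \in L) && (x \in l).
Proof. by rewrite /lines_through !in_fset. Qed.

(** * Polynomials of least degree vanishing on a point set *)

Section MinimalPolynomials.

Variable K : fieldType.
Implicit Types (f g h : {mpoly K[3]}) (P Q : {fset 'rV[K]_3}) (x y : 'rV[K]_3)
  (L : {fset set 'rV[K]_3}).

Definition vanishing Q f : Prop := forall x, x \in Q -> f.@[x 0] = 0.

Definition minimal_on Q f : Prop := [/\ f != 0, vanishing Q f &
  forall g, g != 0 -> vanishing Q g -> (msize f <= msize g)%N].

(** The factor [l] need only have its zeros in a plane. Its zero at [x] rules out a nonzero
    constant, so the cofactor of [l] in a nonzero [f] has smaller degree. *)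
Definition plane_factor f : Prop := exists (x : 'rV[K]_3) (a : 'cV[K]_3) l,
  [/\ a != 0, divides l f, l.@[x 0] = 0 &
      forall y, l.@[y 0] = 0 -> (y - x) *m a = 0].

Lemma plane_factor_mul f h : plane_factor f -> plane_factor (f * h).
Proof.
move=> [x [a [l [a0 [q Dq] lx ly]]]]; exists x, a, l; split=> //.
by exists (q * h); rewrite Dq mulrAC.
Qed.

Lemma msize_gt0 f : (0 < msize f)%N = (f != 0).
Proof. by rewrite lt0n mmeasure_poly_eq0. Qed.

(** A competitor [g] for [f] gives the competitor [g * h] for [f * h]. *)
Lemma minimal_cofactor P f h : minimal_on P (f * h) ->
  minimal_on [fset x in P | h.@[x 0] != 0]%fset f.
Proof.
move=> [fh0 fhP min_fh]; move: (fh0); rewrite mulf_eq0 negb_or => /andP[f0 h0].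
split=> // [x|g g0 gQ].
  rewrite !inE => /andP[/fhP + hx]; rewrite mevalM => /eqP.
  by rewrite mulf_eq0 (negPf hx) orbF => /eqP.
have := min_fh (g * h); rewrite mulf_neq0 // => /(_ isT).
rewrite !msizeM // -!subn1 leq_sub2rE ?addn_gt0 ?msize_gt0 ?g0 //.
rewrite leq_add2r; apply=> x xP; rewrite mevalM.
have [->|hx] := eqVneq h.@[x 0] 0; first by rewrite mulr0.
by rewrite gQ ?mul0r // !inE xP.
Qed.

Lemma exists_minimal P : exists f, minimal_on P f.
Proof.
pose ex d := exists f, [/\ f != 0, vanishing P f & msize f = d].
have [d0 ex_d0] : exists d, `[< ex d >].
  pose f : {mpoly K[3]} := \prod_(x <- P) ('X_0 - (x 0 0)%:MP).
  exists (msize f); apply/asboolP; exists f; split=> //.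
    rewrite prodf_seq_neq0; apply/allP => x _ /=.
    apply/eqP => /(congr1 (mcoeff U_(0))) /eqP.
    by rewrite mcoeffB mcoeffX mcoeffC eqxx mnm1_eq0 mulr0 subr0 mcoeff0 oner_eq0.
  move=> x xP; rewrite /f (big_fsetD1 x xP) /= mevalM mevalB mevalXU mevalC.
  by rewrite subrr mul0r.
have ex_d : exists d, `[< ex d >] by exists d0.
case: (ex_minnP ex_d) => d /asboolP[f [f0 fP Df]] min_d.
exists f; split=> // g g0 gP; rewrite Df; apply: min_d.
by apply/asboolP; exists g.
Qed.

(* If f were of degree at most A then all its points off h would be singular:
   the tangent plane at a smooth point contains more than A lines of the surface. *)
Lemma msize_factor_gt P L f h A :
    (forall l, l \in L -> is_line l) -> minimal_on P (f * h) -> (1 < msize f)%N ->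
    ~ plane_factor f ->
    (forall l x, l \in L -> x \in l -> restr x (dir l) (f * h) = 0) ->
    (forall x, x \in P -> (A < #|` lines_through L x|)%N) ->
  (A.+1 < msize f)%N.
Proof.
move=> lineL min_fh f1 no_plane rfh richP; rewrite ltnNge; apply/negP => le_f.
have [f0 fQ min_f] := minimal_cofactor min_fh.
set Q := [fset x in P | _]%fset in fQ min_f.
have grad0 x : x \in Q -> gradient f x = 0.
  move=> xQ; apply: contrapT => /eqP grad_x; apply: no_plane.
  move: xQ; rewrite !inE => /andP[xP hx].
  pose s := [seq dir l | l <- lines_through L x].
  have sL l : l \in lines_through L x ->
    [/\ is_line l, x \in l & restr x (dir l) f = 0].
    rewrite in_lines_through => /andP[lL xl]; split=> //; first exact: lineL.
    apply/eqP; have /eqP := rfh l x lL xl; rewrite restrM mulf_eq0 => /orP[//|/eqP rh].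
    by case/eqP: hx; have := horner_restr x (dir l) h 0;
      rewrite rh horner0 scale0r addr0.
  have [] := @tangent_plane_divides _ f x (gradient f x) s.
  - exact: grad_x.
  - rewrite map_inj_in_uniq ?fset_uniq // => l l' /sL[ll xl _] /sL[ll' xl' _] Dd.
    by apply: (eq_line ll ll' xl xl' (c := 1)); rewrite scale1r.
  - move=> _ _ /mapP[l /sL[ll xl _] ->] /mapP[l' /sL[ll' xl' _] ->] c Dd.
    by rewrite (eq_line ll ll' xl xl' Dd).
  - move=> _ /mapP[l /sL[ll xl rl] ->]; split=> //; first exact: dir_neq0.
    exact: gradient_restr_eq0.
  - by rewrite size_map (leq_trans le_f) // richP.
  by move=> l [l1 l2 l3]; exists x, (gradient f x), l.
(* All points of [Q] being singular, a nonzero partial derivative would vanish on [Q] in smaller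
   degree than [f]. *)
have df0 i : f^`M(i) = 0.
  apply/eqP; apply: contraT => df.
  suff /(min_f _ df) : vanishing Q f^`M(i) by rewrite leqNgt msize_mderiv.
  move=> x /grad0/matrixP/(_ i 0).
  by rewrite !mxE.
have [x xQ|g [g0 lt_g gQ]] := inseparable_descent f1 df0 (Q := Q); first exact: fQ.
by have := min_f g g0 gQ; rewrite leqNgt lt_g.
Qed.

End MinimalPolynomials.

Lemma card_fset_cond (T : choiceType) (A : {fset T}) (p : pred T) :
  #|` [fset x in A | p x]%fset| = (\sum_(x <- A) p x)%N.
Proof.
rewrite card_fset_sum1 -big_fset_condE big_mkcond.
by apply: eq_bigr => x _; case: (p x).
Qed.

(** * Irreducible factors, interpolation sets and double counting *)

Section Incidences.

Variable K : fieldType.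
Implicit Types (P Q : {fset 'rV[K]_3}) (L : {fset set 'rV[K]_3})
  (l : set 'rV[K]_3) (x y : 'rV[K]_3) (f g h : {mpoly K[3]}).

Definition points_on P (l : set 'rV[K]_3) : {fset 'rV[K]_3} :=
  [fset x in P | x \in l]%fset.

Lemma in_points_on P l x : (x \in points_on P l) = (x \in P) && (x \in l).
Proof. by rewrite /points_on !in_fset. Qed.

Lemma incidencesE L P : incidences L P = (\sum_(x <- P) \sum_(l <- L) (x \in l))%N.
Proof. by apply: eq_bigr => x _; rewrite card_fset_cond. Qed.

Lemma incidences_lines L P : incidences L P = (\sum_(l <- L) #|` points_on P l|)%N.
Proof.
rewrite incidencesE exchange_big; apply: eq_bigr => l _.
by rewrite card_fset_cond.
Qed.

Lemma restr_points P l x f : is_line l -> x \in l ->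
    (forall y, y \in P -> y \in l /\ f.@[y 0] = 0) -> (msize f <= #|` P|)%N ->
  restr x (dir l) f = 0.
Proof.
move=> ll xl Pl; apply: (@restr_eq0 K 3 x (dir l) f P (dir_neq0 ll) (fset_uniq P)).
by move=> y yP; have [yl fy] := Pl y yP; split=> //; apply/(in_line _ ll xl).
Qed.

Lemma restr_line x l f : restr x (dir l) f = 0 -> f.@[x 0] = 0.
Proof.
by move=> rf; have := horner_restr x (dir l) f 0; rewrite rf horner0 scale0r addr0.
Qed.

Lemma card_lines_le L f g : (forall l, l \in L -> is_line l) ->
    mirreducible f -> ~ divides f g ->
    (forall l, l \in L -> exists2 x, x \in l &
       restr x (dir l) f = 0 /\ restr x (dir l) g = 0) ->
  (#|` L| <= (msize f).-1 * (msize g).-1)%N.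
Proof.
move=> lineL irr_f nfg Lfg.
pose l_ (i : 'I_#|` L|) := nth set0 L i.
have lL i : l_ i \in L by apply: mem_nth.
have /choice[x xP] : forall i, exists x, x \in l_ i /\
    (restr x (dir (l_ i)) f = 0 /\ restr x (dir (l_ i)) g = 0).
  by move=> i; have [x] := Lfg _ (lL i); exists x.
apply: (@bezout_lines K f g _ x (fun i => dir (l_ i))) => //.
- by move=> i; apply: dir_neq0; apply: lineL.
- move=> i j ij; have [xi _] := xP i; have [xj _] := xP j.
  have nl : l_ i <> l_ j.
    move/eqP; rewrite nth_uniq ?fset_uniq ?ltn_ord // => /eqP/val_inj/eqP.
    by rewrite (negPf ij).
  have [s xs] := line_exists_notin (lineL _ (lL i)) (lineL _ (lL j)) nl xi.
  exists s => t; apply: contraNneq xs => ->.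
  by apply/(in_line _ (lineL _ (lL j)) xj); exists t.
- by move=> i; have [_ []] := xP i.
- by move=> i; have [_ []] := xP i.
Qed.

(** A nonconstant divisor of least degree is irreducible. *)
Lemma minimal_irreducible_factor (F : {mpoly K[3]}) : (1 < msize F)%N ->
  exists f h, F = f * h /\ mirreducible f.
Proof.
move=> F1; have F0 : F != 0 by apply: contraTneq F1 => ->; rewrite mmeasure0.
pose ex d := exists f h, [/\ F = f * h, (1 < msize f)%N & msize f = d].
have ex_d : exists d, `[< ex d >].
  by exists (msize F); apply/asboolP; exists F, 1; rewrite mulr1.
case: (ex_minnP ex_d) => d /asboolP[f [h [DF f1 Df]]] min_d.
exists f, h; split=> //; split=> // e1 e2 De.
case: (leqP (msize e1) 1) => [|e1_gt1]; first by left.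
case: (leqP (msize e2) 1) => [|e2_gt1]; [by right | exfalso].
have [e10 e20] : e1 != 0 /\ e2 != 0.
  by apply/andP; rewrite -negb_or -mulf_eq0 -De; apply: contraNneq F0 => f0;
    rewrite DF f0 mul0r.
have : (d <= msize e1)%N.
  by apply: min_d; apply/asboolP; exists e1, (e2 * h); rewrite mulrA -De.
rewrite -Df De msizeM //.
by move: (msize e1) (msize e2) e1_gt1 e2_gt1 => a b; lia.
Qed.

Lemma msize_divides f g : divides f g -> g != 0 -> (msize f <= msize g)%N.
Proof.
move=> [q ->]; rewrite mulf_eq0 negb_or => /andP[q0 f0].
by rewrite msizeM // -(prednK (n := msize q)) ?msize_gt0 // addSn leq_addl.
Qed.

(** Some candidate exists: a product of linear factors ['X_0 - x_0] vanishes on [Q], and the prime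
    [f], of degree at least 2, divides none of them. *)
Lemma exists_min_nondivisible f Q : mirreducible f -> (2 < msize f)%N ->
  exists g, [/\ ~ divides f g, vanishing Q g &
    forall p, vanishing Q p -> (msize p < msize g)%N -> divides f p].
Proof.
move=> irr_f f2.
pose ex d := exists g, [/\ ~ divides f g, vanishing Q g & msize g = d].
have ex_d : exists d, `[< ex d >].
  pose g : {mpoly K[3]} := \prod_(x <- Q) ('X_0 - (x 0 0)%:MP).
  exists (msize g); apply/asboolP; exists g; split=> //; last first.
    by move=> x xQ;
      rewrite /g (big_fsetD1 x xQ) /= mevalM mevalB mevalXU mevalC subrr mul0r.
  rewrite /g; apply: (big_ind (fun p => ~ divides f p)).
  - move=> f1; have f0 : f != 0 by apply: contraTneq f2 => ->; rewrite mmeasure0.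
    by have := msize_divides f1 (oner_neq0 _); rewrite mmeasure1; move: f2;
      case: (msize f) => [|[|]].
  - by move=> p q np nq /mirreducible_prime-/(_ irr_f nq).
  - move=> x _ /msize_divides; rewrite leqNgt => /(_ _)/negP; apply.
      apply/eqP => /(congr1 (mcoeff U_(0))) /eqP.
      by rewrite mcoeffB mcoeffX mcoeffC eqxx mnm1_eq0 mulr0 subr0 mcoeff0 oner_eq0.
    apply: leq_ltn_trans f2; apply: leq_trans (mmeasureD_le _ _ _) _.
    by rewrite geq_max mmeasureN mmeasureC msizeX mdeg1; case: (_ != 0).
case: (ex_minnP ex_d) => d /asboolP[g [nfg gQ Dg]] min_d.
exists g; split=> // p pQ; rewrite Dg; apply: contraPP => nfp.
by apply/negP; rewrite -leqNgt; apply: min_d; apply/asboolP; exists p.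
Qed.

Section RichConfiguration.

Variables (P Q : {fset 'rV[K]_3}) (L : {fset set 'rV[K]_3}) (f g h : {mpoly K[3]}).
Variable A : nat.
Hypothesis lineL : forall l, l \in L -> is_line l.
Hypothesis irr_f : mirreducible f.
Hypothesis nfg : ~ divides f g.
Hypothesis min_g : forall p, vanishing Q p -> (msize p < msize g)%N -> divides f p.
Hypothesis LQ : forall l, l \in L -> exists2 x, x \in l &
  restr x (dir l) f = 0 /\ restr x (dir l) g = 0.
Hypothesis richQ : forall x, x \in Q -> (A < #|` lines_through L x|)%N.

(* The points of a minimal B are independent on polynomials of degree < deg g,
   so a line contains at most deg g of them. *)
Lemma interpolation_bound : exists B : {fset 'rV[K]_3}, [/\ (B `<=` Q)%fset,
  (#|{: 'X_{1..3 < (msize g).-1}}| <=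
     #|` B| + #|{: 'X_{1..3 < (msize g).-1.+1 - msize f}}|)%N &
  (A.+1 * #|` B| <= (msize f).-1 * (msize g).-1 ^ 2)%N].
Proof.
have f0 : f != 0 by case: irr_f => f1 _; apply: contraTneq f1 => ->; rewrite mmeasure0.
have g0 : g != 0 by apply/eqP=> g0; apply: nfg; exists 0; rewrite g0 mul0r.
set b := (msize g).-1.
have Db : msize g = b.+1 by rewrite /b prednK // msize_gt0.
pose spans (B : {fset 'rV[K]_3}) :=
  forall p, (msize p <= b)%N -> vanishing B p -> divides f p.
pose ex d := exists B, [/\ (B `<=` Q)%fset, spans B & #|` B| = d].
have ex_d : exists d, `[< ex d >].
  exists #|` Q|; apply/asboolP; exists Q; split=> // p le_p pQ.
  by apply: min_g; rewrite // Db ltnS.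
case: (ex_minnP ex_d) => d /asboolP[B [BQ spanB DB]] min_d.
(* Removing [x] from a smallest spanning [B] frees a polynomial that vanishes on the rest of [B] but
   not at [x]. *)
have dual x : x \in B ->
  exists p, [/\ (msize p <= b)%N, vanishing (B `\ x)%fset p & p.@[x 0] != 0].
  move=> xB; have nspan : ~ spans (B `\ x)%fset.
    move=> span'; have : (d <= #|` (B `\ x)%fset|)%N.
      apply: min_d; apply/asboolP; exists (B `\ x)%fset; split=> //.
      by apply: fsubset_trans BQ; apply: fsubsetDl.
    by rewrite -DB (cardfsD1 x B) xB ltnn.
  apply: contrapT => nex; apply: nspan => p le_p pB; apply: spanB => // y yB.
  have [->|ne_yx] := eqVneq y x; last by apply: pB; rewrite !inE ne_yx.
  by apply/eqP; apply: contrapT => /negP px; apply: nex; exists p.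
(* With more than [b] points of [B] on [l], the dual polynomial of one of them would vanish at [b]
   others, hence on all of [l]. *)
have line_B l : l \in L -> (#|` points_on B l| <= b)%N.
  move=> lL; rewrite leqNgt; apply/negP => lt_b.
  have /fset0Pn[x] : points_on B l != fset0 by rewrite -cardfs_gt0 (leq_trans _ lt_b).
  move=> xBl; move: (xBl); rewrite in_points_on => /andP[xB xl].
  have [p [le_p pB /eqP[]]] := dual x xB.
  apply: (@restr_line x l p); apply: (@restr_points (points_on B l `\ x)%fset) => //.
  - exact: lineL.
  - move=> y; rewrite in_fsetD1 in_points_on => /and3P[ne_yx yB yl]; split=> //.
    by apply: pB; rewrite in_fsetD1 ne_yx.
  - by apply: leq_trans le_p _; move: lt_b; rewrite (cardfsD1 x) xBl.
exists B; split=> //.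
  by apply: card_le_vanishing f0 _ => p le_p pB; apply: spanB.
have : (A.+1 * #|` B| <= \sum_(l <- L) #|` points_on B l|)%N.
  rewrite -incidences_lines card_fset_sum1 big_distrr /=.
  rewrite /incidences !big_seq; apply: leq_sum => x xB; rewrite muln1.
  by apply: richQ; apply: (fsubsetP BQ).
move=> /leq_trans; apply; apply: leq_trans (_ : (\sum_(l <- L) b <= _)%N).
  by rewrite !big_seq; apply: leq_sum => l /line_B.
have := card_lines_le lineL irr_f nfg LQ; rewrite -/b => le_L.
rewrite -[X in (X <= _)%N]/(\sum_(l <- L) b)%N.
have -> : (\sum_(l <- L) b = #|` L| * b)%N.
  by rewrite card_fset_sum1 big_distrl /=; apply: eq_bigr => l _; rewrite mul1n.
by rewrite expnS expn1 mulnA leq_mul2r le_L orbT.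
Qed.

End RichConfiguration.

End Incidences.

(** Here [c1 - c2] is the Hilbert function of a surface of degree [a], on polynomials of degree
    below [a + e]. The first bound will limit the degree of [g], the second the size of [B] from
    below. *)
Lemma hilbert_function_bounds a e c1 c2 q :
  (6 * c1 = (a + e) * (a + e).+1 * (a + e).+2)%N -> (6 * c2 = e * e.+1 * e.+2)%N ->
  (c1 <= q + c2)%N ->
  (3 * a * e.+1 ^ 2 <= 6 * q)%N /\ (a * (a + e) ^ 2 <= 6 * q)%N.
Proof.
move=> E1 E2 le_c.
have a3 : (a <= a * a * a)%N by case: a {E1} => // a; rewrite leq_pmull ?muln_gt0.
have a2 : (a <= a * a)%N by case: a {E1 a3} => // a; rewrite leq_pmull.
by split; nia.
Qed.

(** * Rich configurations without plane factor *)

Section MainInduction.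

Variables (K : fieldType) (n A y : nat).
Hypothesis A_gt5 : (5 < A)%N.
Hypothesis y_large : forall a w, (A < a)%N -> (3 * a * w ^ 2 <= 6 * n)%N ->
  (w <= y.+1)%N.
Implicit Types (P Q : {fset 'rV[K]_3}) (L : {fset set 'rV[K]_3})
  (l : set 'rV[K]_3) (x : 'rV[K]_3) (f g h F : {mpoly K[3]}).

(** The numerical input [y_large] is applied with [w = e.+1], where [e] is the excess of the degree
    of [g] over that of [f]. *)
Lemma no_rich_configuration P L F :
    (forall l, l \in L -> is_line l) -> (#|` P| <= n)%N ->
    minimal_on P F -> (1 < msize F)%N -> ~ plane_factor F ->
    (forall l, l \in L -> (y + msize F <= #|` points_on P l|)%N) ->
    (forall x, x \in P -> (A < #|` lines_through L x|)%N) -> False.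
Proof.
move=> lineL le_P min_F F1 no_plane richL richP.
have [f [h [DF irr_f]]] := minimal_irreducible_factor F1.
have rF l x : l \in L -> x \in l -> restr x (dir l) F = 0.
  move=> lL xl; apply: (@restr_points K (points_on P l) l) => //; first exact: lineL.
    move=> z; rewrite in_points_on => /andP[zP ->]; split=> //.
    by case: min_F => _ /(_ z zP).
  by apply: leq_trans (richL l lL); rewrite leq_addl.
have f1 : (1 < msize f)%N by case: irr_f.
have [F0 FP _] := min_F; move: (F0); rewrite DF mulf_eq0 negb_or => /andP[f0 h0].
have fA : (A.+1 < msize f)%N.
  apply: (@msize_factor_gt K P L f h) => //; rewrite -?DF //.
  by move=> pf; apply: no_plane; rewrite DF; apply: plane_factor_mul.
have := minimal_cofactor (P := P) (f := f) (h := h); rewrite -DF => /(_ min_F).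
set Q := [fset x in P | _]%fset => -[_ fQ min_f].
have QP x : (x \in Q) = (x \in P) && (h.@[x 0] != 0) by rewrite /Q !in_fset.
have [|g [nfg gQ min_g]] := exists_min_nondivisible Q irr_f.
  by apply: leq_ltn_trans fA; move: A_gt5; lia.
have g0 : g != 0 by apply/eqP=> g0; apply: nfg; exists 0; rewrite g0 mul0r.
have le_fg := min_f g g0 gQ.
have le_Q : (#|` Q| <= n)%N.
  by apply: leq_trans le_P; apply/fsubset_leq_card/fsubsetP => x; rewrite QP => /andP[].
(* Multiples of [f] are the only polynomials of degree below that of [g] vanishing on [Q], so the
   Hilbert function of [f] there is at most [n]. *)
have le_g : (msize g <= y + msize f)%N.
  have := @card_le_vanishing K 3 f (msize g).-1 Q f0; rewrite prednK ?msize_gt0 //.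
  have min_g' p : (msize p <= (msize g).-1)%N ->
    {in Q, forall x : 'rV[K]_3, p.@[x 0] = 0} -> divides f p.
    by move=> le_p pQ; apply: min_g;
      rewrite // -(prednK (n := msize g)) ?msize_gt0 // ltnS.
  move=> /(_ min_g') le_N.
  have Dg : ((msize g).-1 = (msize f).-1 + (msize g - msize f))%N.
    by move: (msize f) (msize g) le_fg fA => a b; lia.
  have E1 := card_bmnm3 (msize g).-1; have E2 := card_bmnm3 (msize g - msize f).
  have [|bnd _] := @hilbert_function_bounds (msize f).-1 _ _ _ _ _ E2 le_N.
    by rewrite -Dg.
  have lt_a : (A < (msize f).-1)%N by move: (msize f) fA => a; lia.
  have : ((msize g - msize f).+1 <= y.+1)%N.
    by apply: (y_large lt_a); apply: leq_trans bnd _; rewrite leq_mul2l le_Q orbT.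
  by move: (msize f) (msize g) le_fg fA => a b; lia.
pose LQ := [fset l in L | points_on Q l != fset0]%fset.
have LQP l : (l \in LQ) = (l \in L) && (points_on Q l != fset0) by rewrite /LQ !in_fset.
have lineLQ l : l \in LQ -> is_line l by rewrite LQP => /andP[/lineL].
(* On a line meeting [Q] the cofactor [h] is not identically zero, so it vanishes at fewer than
   [msize h] points. At least [y + msize f >= msize g] points of [Q] remain on the line, which
   forces [g] to vanish along it. *)
have rLQ l : l \in LQ -> exists2 x, x \in l &
    restr x (dir l) f = 0 /\ restr x (dir l) g = 0.
  rewrite LQP => /andP[lL /fset0Pn[x]];
    rewrite in_points_on QP => /andP[/andP[xP hx] xl].
  have ll := lineL l lL.
  have rh : restr x (dir l) h != 0.
    by apply: contraNneq hx => /restr_line ->.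
  exists x => //; split.
    by apply/eqP; have /eqP := rF l x lL xl; rewrite DF restrM mulf_eq0 (negPf rh) orbF.
  apply: (@restr_points K (points_on Q l) l) => //.
    by move=> z; rewrite in_points_on => /andP[/gQ].
  pose Z := [fset z in points_on P l | h.@[z 0] == 0]%fset.
  have inZ z : (z \in Z) = (z \in points_on P l) && (h.@[z 0] == 0) by rewrite /Z
    in_fset.
  have lt_h : (#|` Z| < msize h)%N.
    rewrite ltnNge; apply: contra rh => le_h; apply/eqP.
    apply: (@restr_points K _ l x h ll xl _ le_h) => z.
    by rewrite inZ in_points_on => /andP[/andP[_ zl] /eqP].
  have : (#|` points_on P l| <= #|` points_on Q l| + #|` Z|)%N.
    apply: leq_trans (leq_card_fsetU _ _); apply/fsubset_leq_card/fsubsetP => z.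
    rewrite in_fsetU inZ !in_points_on QP => /andP[-> ->].
    by case: eqP.
  have := richL l lL; rewrite DF msizeM //.
  by move: (msize f) (msize g) (msize h) le_g lt_h f1 => a b c; lia.
have richQ x : x \in Q -> (A < #|` lines_through LQ x|)%N.
  move=> xQ; move: (xQ); rewrite QP => /andP[xP _]; apply: leq_trans (richP x xP) _.
  apply/fsubset_leq_card/fsubsetP => l; rewrite !in_lines_through LQP.
  move=> /andP[-> xl]; rewrite xl andbT /=; apply/fset0Pn; exists x.
  by rewrite in_points_on xQ.
have [B [_ le_N le_B]] := interpolation_bound lineLQ irr_f nfg min_g rLQ richQ.
have Dg : ((msize g).-1 = (msize f).-1 + (msize g - msize f))%N.
  by move: (msize f) (msize g) le_fg fA => a b; lia.
have E1 := card_bmnm3 (msize g).-1; have E2 := card_bmnm3 (msize g - msize f).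
rewrite prednK ?msize_gt0 // in le_N.
have [|_ bnd] := @hilbert_function_bounds (msize f).-1 _ _ _ _ _ E2 le_N;
  first by rewrite -Dg.
rewrite -Dg in bnd.
have ab_gt0 : (0 < (msize f).-1 * (msize g).-1 ^ 2)%N.
  rewrite muln_gt0 expn_gt0; move: (msize f) (msize g) le_fg f1 => a b; lia.
(* As [A.+1] is at least 7, the upper bound on [A.+1] times the size of [B] contradicts the lower
   bound on 6 times that size. *)
by move: A_gt5 le_B bnd ab_gt0; move: (_ * _)%N #|` B| => u v; nia.
Qed.

End MainInduction.

(** * Incidences in a plane and the induction *)

Lemma is_plane_orthogonal (K : fieldType) (x : 'rV[K]_3) (a : 'cV[K]_3) : a != 0 ->
  is_plane [set y | (y - x) *m a = 0]%classic.
Proof.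
move=> a0; pose phi : 'Hom('rV[K]_3, 'rV[K]_1) := linfun (mulmxr a).
exists x, (lker phi); split; last first.
  apply/seteqP; split => y /=; rewrite memv_ker lfunE /=.
    by move=> ->.
  by move/eqP.
have := limg_ker_dim phi fullv; rewrite capfv dimvf /dim /= mul1n.
have : \dim (limg phi) = 1%N.
  apply/eqP; rewrite eqn_leq; apply/andP; split.
    by rewrite (leq_trans (dimvS (subvf _))) // dimvf /dim /= mul1n.
  rewrite lt0n dimv_eq0; apply: contraNneq a0 => phi0.
  apply/eqP/matrixP => i j; rewrite ord1 [RHS]mxE.
  have : phi (delta_mx 0 i) \in (limg phi) by apply/memv_img/memvf.
  rewrite phi0 memv0 lfunE /= -rowE => /eqP/matrixP/(_ 0 0).
  by rewrite !mxE.
by move=> -> /eqP; rewrite addn1 eqSS => /eqP.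
Qed.

Lemma in_lines_in (K : fieldType) (L : {fset set 'rV[K]_3}) H l :
  (l \in lines_in L H) = (l \in L) && `[< (l `<=` H)%classic >].
Proof. by rewrite /lines_in in_fset. Qed.

(* r <= 1 + r (r - 1) / 2, and two lines meet in at most one point. *)
Lemma incidences_pairs (K : fieldType) (L : {fset set 'rV[K]_3}) (P : {fset 'rV[K]_3}) :
  (forall l, l \in L -> is_line l) ->
  (incidences L P <= #|` P| + 'C(#|` L|, 2))%N.
Proof.
move=> lineL.
have le_r r : (2 * r <= 2 + r * r.-1)%N by case: r => [|[|[|r]]] //=; lia.
have pairs x : (#|` lines_through L x| * #|` lines_through L x|.-1 =
    \sum_(l <- L) \sum_(l' <- (L `\ l)%fset) (x \in l) * (x \in l'))%N.
  transitivity (\sum_(l <- L) (x \in l) * #|` lines_through L x|.-1)%N.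
    by rewrite -big_distrl /= -card_fset_cond.
  rewrite !big_seq; apply: eq_bigr => l; rewrite -[_ \in _]/(l \in L) => lL.
  rewrite -big_distrr /=.
  case xl: (x \in l); rewrite ?mul0n // !mul1n -card_fset_cond.
  rewrite -[RHS]/(#|` lines_through (L `\ l)%fset x|).
  rewrite (cardfsD1 l (lines_through L x)) in_lines_through lL xl /=; congr #|` _|.
  by apply/fsetP => l'; rewrite in_fsetD1 !in_lines_through in_fsetD1 andbA.
have meet l l' : l \in L -> l' \in (L `\ l)%fset ->
    (\sum_(x <- P) (x \in l) * (x \in l') <= 1)%N.
  move=> lL; rewrite in_fsetD1 => /andP[nll' l'L].
  rewrite (eq_bigr (fun x => (x \in l) && (x \in l') : nat)); last by move=> x _;
    rewrite mulnb.
  rewrite -card_fset_cond; set S := [fset x in P | _]%fset.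
  have [->|/fset0Pn[z zS]] := eqVneq S fset0; first by rewrite cardfs0.
  apply: leq_trans (_ : #|` [fset z]%fset| <= _)%N; last by rewrite cardfs1.
  apply/fsubset_leq_card/fsubsetP => y; rewrite in_fset1; move: zS.
  rewrite !in_fset /= => /and3P[_ zl zl'] /and3P[_ yl yl'].
  apply: contraNT nll' => ne_yz; apply/eqP.
  exact: (eq_line2 (lineL _ l'L) (lineL _ lL) ne_yz).
suff : (2 * incidences L P <= 2 * #|` P| + #|` L| * #|` L|.-1)%N.
  have := bin_ffact #|` L| 2; rewrite ffactnS ffactn1 (_ : 2`! = 2%N) // => <-.
  by lia.
apply: leq_trans (_ : \sum_(x <- P) (2 + #|` lines_through L x| * #|` lines_through L
  x|.-1) <= _)%N.
  by rewrite /incidences big_distrr /=; apply: leq_sum => x _; apply: le_r.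
rewrite big_split /= card_fset_sum1 [(2 * _)%N]big_distrr /= leq_add2l.
under eq_bigr => x _ do rewrite pairs.
rewrite exchange_big /=.
apply: leq_trans (_ : \sum_(l <- L) #|` L|.-1 <= _)%N; last first.
  by rewrite [in X in (_ <= X * _)%N]card_fset_sum1 big_distrl /=;
    apply: leq_sum => l _; rewrite mul1n.
rewrite !big_seq; apply: leq_sum => l; rewrite -[_ \in _]/(l \in L) => lL.
rewrite exchange_big /= (cardfsD1 l L) lL /= card_fset_sum1 !big_seq.
by apply: leq_sum => l'; rewrite -[_ \in _]/(l' \in (L `\ l)%fset); apply: meet.
Qed.

Lemma fset_split (T : choiceType) (S : {fset T}) (p : pred T) (F : T -> nat) :
  (\sum_(x <- S) F x = \sum_(x <- [fset x in S | p x]%fset) F x +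
                       \sum_(x <- [fset x in S | ~~ p x]%fset) F x)%N.
Proof. exact: big_fsetID. Qed.

(** A line outside the plane meets it at most once, which costs one per line; the lines inside are
    counted by pairs. *)
Lemma incidences_plane (K : fieldType) (L : {fset set 'rV[K]_3}) (P : {fset 'rV[K]_3})
    (x : 'rV[K]_3) (a : 'cV[K]_3) k :
    (forall l, l \in L -> is_line l) ->
    (forall z, z \in P -> (z - x) *m a = 0) ->
    (#|` lines_in L [set y | ((y - x) *m a = 0)%R]%classic| <= k)%N ->
  (incidences L P <= #|` L| + #|` P| + 'C(k, 2))%N.
Proof.
move=> lineL PH; set H := [set y | _]%classic => le_k.
rewrite incidences_lines (fset_split _ (fun l => `[< (l `<=` H)%classic >])).
rewrite -[X in (X + _ <= _)%N]/(\sum_(l <- lines_in L H) #|` points_on P l|)%N.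
rewrite -incidences_lines.
have le_in : (incidences (lines_in L H) P <= #|` P| + 'C(k, 2))%N.
  apply: leq_trans (incidences_pairs _ _) _.
    by move=> l; rewrite in_lines_in => /andP[/lineL].
  by rewrite leq_add2l leq_bin2l.
suff le_out : (\sum_(l <- [fset l in L | ~~ `[< (l `<=` H)%classic >]]%fset) #|`
  points_on P l| <= #|` L|)%N.
  by apply: leq_trans (leq_add le_in le_out) _; rewrite addnC addnA.
rewrite -big_fset_condE card_fset_sum1 big_mkcond !big_seq; apply: leq_sum => l.
rewrite -[_ \in _]/(l \in L) => lL; case: asboolP => //= nlH.
have ll := lineL l lL.
have [->|/fset0Pn[z]] := eqVneq (points_on P l) fset0; first by rewrite cardfs0.
rewrite in_points_on => /andP[zP zl].
apply: leq_trans (_ : #|` [fset z]%fset| <= _)%N; last by rewrite cardfs1.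
apply/fsubset_leq_card/fsubsetP => y; rewrite in_fset1 in_points_on => /andP[yP yl].
apply/eqP; apply: contrapT => /eqP ne_yz; apply: nlH => w /mem_set wl /=.
have /(in_line _ ll zl)[t Dt] := yl.
have t0 : t != 0 by apply: contraNneq ne_yz => t0; rewrite Dt t0 scale0r addr0.
have da : dir l *m a = 0.
  apply: (scalerI t0); rewrite scaler0 scalemxAl.
  have := PH y yP; rewrite Dt addrAC mulmxDl (PH z zP) add0r //.
have /(in_line _ ll zl)[s ->] := wl.
by rewrite /H /= addrAC mulmxDl (PH z zP) add0r -scalemxAl da scaler0.
Qed.

Section MainInduction.

Variables (K : fieldType) (n A y k : nat).
Hypothesis A_gt5 : (5 < A)%N.
Hypothesis y_large : forall a w, (A < a)%N -> (3 * a * w ^ 2 <= 6 * n)%N ->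
  (w <= y.+1)%N.

(** Each step of the induction is paid by one part of the bound: a split plane by a drop in the
    degree of [F], a removed line by its coefficient, a removed point by [A]. *)
Lemma incidences_le (L : {fset set 'rV[K]_3}) (P : {fset 'rV[K]_3}) (F : {mpoly K[3]}) :
    (forall l, l \in L -> is_line l) ->
    (forall H, is_plane H -> (#|` lines_in L H| <= k)%N) ->
    (#|` P| <= n)%N -> minimal_on P F ->
  (incidences L P <= (y + (msize F).-1) * #|` L| + A * #|` P| + (msize F).-1 * 'C(k,
    2))%N.
Proof.
have [N] := ubnP (#|` L| + #|` P|); elim: N L P F => // N IHN L P F.
rewrite ltnS => le_N lineL planeL le_P min_F.
have [F0 FP minF] := min_F.
have [pf|no_plane] := pselect (plane_factor F).
  have [x [a [l [a0 [q Dq] lx ly]]]] := pf.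
  pose H := [set z | (z - x) *m a = 0]%classic.
  pose P1 := [fset z in P | ~~ ((z - x) *m a == 0)]%fset.
  pose P2 := [fset z in P | (z - x) *m a == 0]%fset.
  have inP1 z : (z \in P1) = (z \in P) && ((z - x) *m a != 0) by rewrite /P1 in_fset.
  have inP2 z : (z \in P2) = (z \in P) && ((z - x) *m a == 0) by rewrite /P2 in_fset.
  have cardP : #|` P| = (#|` P2| + #|` P1|)%N.
    by rewrite !card_fset_sum1 (fset_split _ (fun z => (z - x) *m a == 0)).
  have -> : incidences L P = (incidences L P2 + incidences L P1)%N.
    by rewrite /incidences (fset_split _ (fun z => (z - x) *m a == 0)).
  have /andP[q0 l0] : (q != 0) && (l != 0) by rewrite -negb_or -mulf_eq0 -Dq.
  have l1 : (1 < msize l)%N.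
    rewrite ltnNge; apply: contra l0 => /msize1_polyC Dl.
    by move: lx; rewrite Dl mevalC => ->.
  have qP1 : vanishing P1 q.
    move=> z; rewrite inP1 => /andP[zP zH]; have := FP z zP.
    rewrite Dq mevalM => /eqP; rewrite mulf_eq0 => /orP[/eqP//|/eqP/ly zH'].
    by rewrite zH' eqxx in zH.
  have lt_q : (msize q < msize F)%N.
    have := msize_gt0 q; rewrite Dq msizeM // q0.
    by move: (msize q) (msize l) l1 => d e; lia.
  (* The plane contains a point of [P], or else [q] would contradict the minimality of [F]; so the
     induction measure decreases. *)
  have P2_gt0 : (0 < #|` P2|)%N.
    rewrite cardfs_gt0; apply/eqP => P20.
    have /(minF q q0) : vanishing P q; last by rewrite leqNgt lt_q.
    move=> z zP; apply: qP1; rewrite inP1 zP /=; apply/negP => zH.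
    by have := in_fset0 z; rewrite -P20 inP2 zP zH.
  have [F1 min_F1] := exists_minimal P1.
  have le_F1 : (msize F1 <= msize q)%N by case: min_F1 => _ _ /(_ q q0 qP1).
  have := IHN L P1 F1 _ lineL planeL _ min_F1.
  have -> : (#|` L| + #|` P1| < N)%N by apply: leq_trans le_N; rewrite cardP; lia.
  have -> : (#|` P1| <= n)%N by apply: leq_trans le_P; rewrite cardP leq_addl.
  move=> /(_ isT isT) bound1.
  have bound2 : (incidences L P2 <= #|` L| + #|` P2| + 'C(k, 2))%N.
    apply: (incidences_plane (x := x) (a := a)) => //.
      by move=> z; rewrite inP2 => /andP[_ /eqP].
    by apply: planeL; apply: is_plane_orthogonal.
  have q_gt0 : (0 < msize q)%N by rewrite msize_gt0.
  move: (msize F) (msize q) (msize F1) q_gt0 lt_q le_F1 bound1 => d e d1 e0 lt_e le_d1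
    bound1.
  (* The drop in degree frees one unit per line and one ['C(k, 2)], exactly the cost of the plane
     apart from its points. *)
  have : (1 + d1.-1 <= d.-1)%N by lia.
  by rewrite cardP;
    move: (d.-1) (d1.-1) bound1 => {e0 lt_e le_d1} {}d {}d1 bound1 le_d; nia.
have [poor|/forallNP richL] := pselect (exists l, l \in L /\
    (#|` points_on P l| <= y + (msize F).-1)%N).
  have [l [lL le_l]] := poor.
  have L'L l' : l' \in (L `\ l)%fset -> l' \in L by rewrite in_fsetD1 => /andP[].
  have bound1 : (incidences (L `\ l)%fset P <= (y + (msize F).-1) * #|` (L `\ l)%fset| +
      A * #|` P| + (msize F).-1 * 'C(k, 2))%N.
    apply: IHN => // [|l' /L'L /lineL//|H planeH].
      by apply: leq_trans le_N; rewrite (cardfsD1 l L) lL.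
    apply: leq_trans (planeL H planeH); apply/fsubset_leq_card/fsubsetP => l'.
    by rewrite !in_lines_in => /andP[/L'L -> ->].
  rewrite (cardfsD1 l L) lL incidences_lines (big_fsetD1 l lL) /= -incidences_lines.
  by apply: leq_trans (leq_add le_l bound1) _; rewrite mulnDr muln1 !addnA.
have [poor|/forallNP richP] := pselect (exists x, x \in P /\
    (#|` lines_through L x| <= A)%N).
  have [x [xP le_x]] := poor.
  have P'P z : z \in (P `\ x)%fset -> z \in P by rewrite in_fsetD1 => /andP[].
  have [F1 min_F1] := exists_minimal (P `\ x)%fset.
  have le_F1 : (msize F1 <= msize F)%N.
    by case: min_F1 => _ _; apply=> // z /P'P /FP.
  have bound1 : (incidences L (P `\ x)%fset <= (y + (msize F1).-1) * #|` L| +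
      A * #|` (P `\ x)%fset| + (msize F1).-1 * 'C(k, 2))%N.
    apply: IHN => //; first by apply: leq_trans le_N; rewrite (cardfsD1 x P) xP addnCA.
    by apply: leq_trans le_P; rewrite (cardfsD1 x P) xP leq_addl.
  have -> : incidences L P = (#|` lines_through L x| + incidences L (P `\ x)%fset)%N.
    by rewrite /incidences (big_fsetD1 x xP).
  rewrite (cardfsD1 x P) xP.
  have : ((msize F1).-1 <= (msize F).-1)%N by move: (msize F1) (msize F) le_F1; lia.
  move: (msize F).-1 (msize F1).-1 bound1 => d d1 bound1 le_d.
  by move: (incidences _ _) bound1 => i bound1; nia.
(* A nonzero constant vanishes on [P] only if [P] is empty. *)
have [F1|] := ltnP 1 (msize F); last first.
  move=> /msize1_polyC DF.
  have -> : P = fset0.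
    apply/fsetP => z; rewrite in_fset0; apply/negP => /FP; rewrite DF mevalC => F00.
    by move/eqP: F0; apply; rewrite DF F00.
  by rewrite /incidences big_nil.
exfalso; apply: (no_rich_configuration A_gt5 y_large lineL le_P min_F F1 no_plane).
  move=> l lL; rewrite leqNgt; apply/negP => lt_l; case: (richL l); split=> //.
  by move: lt_l F1; move: (msize F) => d; lia.
by move=> x xP; rewrite ltnNge; apply/negP => le_x; case: (richP x).
Qed.

End MainInduction.

(** * Numerical estimates *)

(** Only 0 vanishes on [P] in degree below that of [F], so the number of such monomials is at most
    that of the points. *)
Lemma minimal_degree_cube (K : fieldType) (P : {fset 'rV[K]_3}) (F : {mpoly K[3]}) :
  minimal_on P F -> ((msize F).-1 ^ 3 <= 6 * #|` P|)%N.
Proof.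
move=> [F0 _ minF]; have := @card_le_vanishing0 K 2 (msize F).-1 P.
have H p : (msize p <= (msize F).-1)%N ->
  {in P, forall x : 'rV[K]_3, p.@[x 0] = 0} -> p = 0.
  move=> le_p pP; apply/eqP; apply: contraT => p0.
  have := minF p p0 pP; rewrite leqNgt -(prednK (n := msize F)) ?msize_gt0 //.
  by rewrite ltnS le_p.
move=> /(_ H) le_N; apply: leq_trans (_ : 6 * #|{: 'X_{1..3 < (msize F).-1}}| <= _)%N.
  by rewrite card_bmnm3; nia.
by rewrite leq_mul2l le_N orbT.
Qed.

(** Absorbs the degree bound [1.82 u^5] into [2.45 u^6]; the 1 is gained by taking [y = z.-1]. *)
Lemma sextic_ge (R : realFieldType) (u : R) : 1 <= u ->
  182 / 100 * u ^+ 5 <= 145 / 100 * u ^+ 6 + 1.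
Proof.
move=> u1; have u5 : 0 <= u ^+ 5 by rewrite exprn_ge0 //; lra.
rewrite (exprS u 5).
have [le_u|lt_u] := leP (126 / 100) u; first by nra.
have mono (v : R) : u <= v -> u ^+ 5 <= v ^+ 5 by move=> uv; rewrite lerXn2r ?nnegrE;
  lra.
have [le_u|gt_u] := leP u (11 / 10).
  have := mono _ le_u.
  have : (11 / 10) ^+ 5 <= 17 / 10 :> R by rewrite !exprS expr0; lra.
  by nra.
have := mono _ (ltW lt_u).
have : (126 / 100) ^+ 5 <= 32 / 10 :> R by rewrite !exprS expr0; lra.
by nra.
Qed.

Lemma powR_root15 (R : realType) (x : R) (k : nat) (r : R) : 0 <= x ->
  r * 15 = k%:R -> x `^ r = (x `^ (1 / 15)) ^+ k.
Proof.
move=> x0 rk; rewrite -powR_mulrn ?powR_ge0 // -powRrM; congr (_ `^ _).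
by rewrite -rk; field.
Qed.

Theorem theorem4 (R : realType) (K : fieldType) (m n : nat)
    (L : {fset set 'rV[K]_3}) (P : {fset 'rV[K]_3}) (c : R)
    (hline : forall l : set 'rV[K]_3, l \in L -> is_line l)
    (hm : #|` L| = m) (hn : #|` P| = n)
    (hplane : forall H : set 'rV[K]_3, is_plane H ->
       #|` lines_in L H|%:R <= c * Num.sqrt (m%:R : R)) :
  (incidences L P)%:R <=
    245 / 100 * m%:R * n%:R `^ (2 / 5) +
    245 / 100 * n%:R `^ (6 / 5) +
    91 / 100 * c ^+ 2 * m%:R * n%:R `^ (1 / 3) +
    674 / 100 * n%:R.
Proof.
have [n0|n_gt0] := posnP n.
  have -> : P = fset0 by apply: cardfs0_eq; rewrite hn.
  rewrite /incidences big_nil mulr0n n0.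
  rewrite !powR0 ?mulr0 ?addr0 //; by apply: lt0r_neq0; lra.
have n1 : 1 <= n%:R :> R by rewrite ler1n.
set x : R := n%:R in n1 *; have x0 : 0 <= x by lra.
(* Every power of n in the bound is a power of u. *)
pose u := x `^ (1 / 15).
rewrite (@powR_root15 R x 6) // -/u; last by field.
rewrite (@powR_root15 R x 18) // -/u; last by field.
rewrite (@powR_root15 R x 5) // -/u; last by field.
have Dx : x = u ^+ 15 by rewrite -(@powR_root15 R x 15 1) ?powRr1 //; field.
have u1 : 1 <= u.
  rewrite leNgt; apply/negP => u_lt1.
  have : u ^+ 15 < 1 by rewrite exprn_ilt1 ?powR_ge0.
  by rewrite -Dx; lra.
have u_ge0 d : 0 <= u ^+ d by rewrite exprn_ge0 //; lra.
(* Any plane gives this, as the number of lines in it is nonnegative; truncation requires it. *)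
have c_ge0 : 0 <= c * Num.sqrt (m%:R : R).
  have a0 : delta_mx 0 0 != 0 :> 'cV[K]_3.
    by apply/eqP => /matrixP/(_ 0 0); rewrite !mxE => /eqP; rewrite oner_eq0.
  by apply: le_trans (hplane _ (is_plane_orthogonal 0 a0)); apply: ler0n.
pose A := Num.truncn (674 / 100 + 245 / 100 * u ^+ 3).
pose z := Num.truncn (u ^+ 6).
pose k := Num.truncn (c * Num.sqrt (m%:R : R)).
have A_ge0 : 0 <= 674 / 100 + 245 / 100 * u ^+ 3 by have := u_ge0 3; lra.
have z_gt0 : (0 < z)%N by rewrite truncn_gt0 exprn_ege1.
have A_gt5 : (5 < A)%N by rewrite truncn_ge_nat //; have := u_ge0 3; lra.
(* From [a >= 2 u^3] and [n = u^15] follows [w^2 <= u^12], hence [w <= z]. *)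
have z_large a w : (A < a)%N -> (3 * a * w ^ 2 <= 6 * n)%N -> (w <= z.-1.+1)%N.
  rewrite prednK // truncn_ge_nat // => lt_a.
  have {}lt_a : 2 * u ^+ 3 <= a%:R.
    have := truncnS_gt (674 / 100 + 245 / 100 * u ^+ 3); rewrite -/A.
    have : A.+1%:R <= a%:R :> R by rewrite ler_nat.
    by have := u_ge0 3; lra.
  rewrite -(ler_nat R) !natrM -/x Dx => le_w.
  rewrite -(@ler_pXn2r _ 2) ?nnegrE ?ler0n // -exprM.
  have u3 : 0 < u ^+ 3 by rewrite exprn_gt0 //; lra.
  rewrite -(ler_pM2l u3) -exprD.
  have : 0 <= w%:R ^+ 2 :> R by rewrite sqr_ge0.
  by nra.
have planes H : is_plane H -> (#|` lines_in L H| <= k)%N.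
  by move=> /hplane le_H; rewrite truncn_ge_nat.
have [F min_F] := exists_minimal P.
have le_n : (#|` P| <= n)%N by rewrite hn.
have := incidences_le A_gt5 z_large hline planes le_n min_F.
have := minimal_degree_cube min_F; rewrite hm hn.
set d := (msize F).-1 => le_d le_I.
(* The constant is a cube root of 6 rounded up; its half is the 0.91 of the bound. *)
have {}le_d : d%:R <= 182 / 100 * u ^+ 5.
  have rhs0 : 0 <= 182 / 100 * u ^+ 5 by apply: mulr_ge0 => //; lra.
  rewrite -(@ler_pXn2r _ 3) ?nnegrE ?ler0n //.
  move: le_d; rewrite -(ler_nat R) natrX natrM -/x Dx exprMn -exprM => le_d.
  apply: le_trans le_d _; apply: ler_wpM2r => //.
  by rewrite !exprS expr0; lra.
have le_zd : (z.-1 + d)%:R <= 245 / 100 * u ^+ 6.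
  have z_le : z%:R <= u ^+ 6 by rewrite truncn_le.
  have Dz : z%:R = z.-1%:R + 1 :> R by rewrite -[in LHS](prednK z_gt0) -addn1 natrD.
  by have := sextic_ge u1; rewrite natrD; lra.
have le_A : A%:R <= 674 / 100 + 245 / 100 * u ^+ 3 by rewrite truncn_le.
have le_k : ('C(k, 2))%:R <= 1 / 2 * (c ^+ 2 * m%:R) :> R.
  have : k%:R ^+ 2 <= c ^+ 2 * m%:R :> R.
    rewrite -[X in _ * X](@sqr_sqrtr _ m%:R) ?ler0n // -exprMn.
    by rewrite ler_pXn2r ?nnegrE ?ler0n // truncn_le.
  have : (2 * 'C(k, 2) <= k ^ 2)%N.
    by rewrite mulnC -[2%N]/(2`!) bin_ffact ffactnS ffactn1 expnS expn1 leq_mul2l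
      leq_pred orbT.
  by rewrite -(ler_nat R) natrX natrM; lra.
move: le_I; rewrite -(ler_nat R) !natrD !natrM -/x => /le_trans; apply.
have -> : u ^+ 18 = u ^+ 3 * x by rewrite Dx -exprD.
have M0 : 0 <= m%:R :> R by rewrite ler0n.
have C0 : 0 <= c ^+ 2 * m%:R by rewrite mulr_ge0 ?sqr_ge0.
have h1 : (z.-1 + d)%:R * m%:R <= 245 / 100 * u ^+ 6 * m%:R by rewrite ler_wpM2r.
have h2 : A%:R * x <= (674 / 100 + 245 / 100 * u ^+ 3) * x by rewrite ler_wpM2r.
have h3 : d%:R * ('C(k, 2))%:R <= 182 / 100 * u ^+ 5 * (1 / 2 * (c ^+ 2 * m%:R)).
  by rewrite ler_pM ?ler0n.
by lra.
Qed.
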